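(* Assume that $T$ has dependent dividing. Let $p(x)$ be a type over a set $C$ and let $k<\omega$. Then the following are equivalent: (1) $\mathrm{bdn}(p)\ge k$. (2) There is a $C$-indiscernible sequence $I$ and an NIP formula $\varphi(x,y)$ such that $p(x)$ has $VC^*_\varphi$-density at least $k$ over $I$. (3) There is a $C$-indiscernible sequence $I$ and an NIP formula $\varphi(x,y)$ such that $p(x)$ has $VC^*$-density bigger than $k-1$ with respect to $\varphi(x,y)$ over $I$.
   Context: $T$ is a complete first-order theory; all elements, tuples, sequences and (small) parameter sets live in a monster model of $T$. No distinction is made between singletons and tuples. Dependent dividing: $T$ has dependent dividing if for all models $M\preceq N$ of $T$ and every $p(x)\in S(N)$ dividing over $M$, there are an NIP formula $\phi(x;y)$ and $c\in N$ such that $\phi(x,c)\in p(x)$ and $\phi(x,c)$ divides over $M$. Burden: an inp-pattern of depth $\kappa$ in $p(x)$ consists of $(b_{\alpha,i})_{\alpha<\kappa,i<\omega}$, formulas $(\phi_\alpha(x,y_\alpha))_{\alpha<\kappa}$ and $k_\alpha<\omega$ such that for each $\alpha<\kappa$, $\{\phi_\alpha(x,b_{\alpha,i})\}_{i<\omega}$ is $k_\alpha$-inconsistent, and for every $f:\kappa\to\omega$, $\{\phi_\alpha(x,b_{\alpha,f(\alpha)})\}_{\alpha<\kappa}\cup p(x)$ is consistent. $\mathrm{bdn}(p)$ is the maximum (if it exists) of the depths of inp-patterns in $p(x)$; if the supremum of the depths is $\kappa$ but is not attained, $\mathrm{bdn}(p)=\kappa_-$. Dual VC density: for a formula $\varphi(x,y)$,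 a sequence $I$ of $|y|$-tuples, and a finite set $A$ of terms of $I$, let $S^{p(x)}_\varphi(A)$ denote the set of all complete $\varphi$-types in $x$ over $A$ (maximal consistent sets of formulas $\varphi(x,b)$, $\neg\varphi(x,b)$ with $b\in A$) which are consistent with $p(x)$. The $VC^*_\varphi$-density of $p(x)$ over $I$ (also called the $VC^*$-density of $p(x)$ with respect to $\varphi(x,y)$ over $I$) is $\inf\{r\in\mathbb{R}^{\ge 0}: |S^{p(x)}_\varphi(A)|=O(|A|^r)\text{ for all finite }A\subseteq I\}$; formally, the condition on $r$ means that there is a function $f:\mathbb{N}\to\mathbb{R}_+$ with $f(n)=O(n^r)$ and $|S^{p(x)}_\varphi(A)|\le f(|A|)$ for all finite $A\subseteq I$. *)

(* Defs.v *)
From HB Require Import structures.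
From mathcomp Require Import all_boot all_order all_algebra.
From mathcomp Require Import all_classical all_reals all_analysis.

Set Implicit Arguments.
Unset Strict Implicit.
Unset Printing Implicit Defensive.

Import Order.TTheory GRing.Theory Num.Theory.
Import numFieldNormedType.Exports.

Local Open Scope classical_set_scope.
Local Open Scope ring_scope.
Local Open Scope card_scope.

Record language := Language {
  fsym : Type;
  rsym : Type;
  far : fsym -> nat;
  rar : rsym -> nat }.

Inductive term (L : language) (V : Type) : Type :=
| Var (v : V)
| App (f : fsym L) (ts : 'I_(far f) -> term L V).

(* [formula L V]: first-order formulas with free variables in [V]. A
   quantifier binds the variable [None] of [option V]. A formula phi(x; y) with
   |x| = n and |y| = m is an element of [formula L ('I_n + 'I_m)]. *)
Inductive formula (L : language) (V : Type) : Type :=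
| FEq (s t : term L V)
| FRel (r : rsym L) (ts : 'I_(rar r) -> term L V)
| FBot
| FImp (phi psi : formula L V)
| FAll (phi : formula L (option V)).

Arguments FBot {L V}.

Definition FNeg (L : language) (V : Type) (phi : formula L V) : formula L V :=
  FImp phi FBot.

Record structure (L : language) := Structure {
  carrier :> Type;
  fint : forall f : fsym L, ('I_(far f) -> carrier) -> carrier;
  rint : forall r : rsym L, ('I_(rar r) -> carrier) -> Prop;
  carrier_inhabited : inhabited carrier }.

Fixpoint teval (L : language) (U : structure L) (V : Type) (t : term L V)
    (v : V -> U) : U :=
  match t with
  | Var x => v x
  | App f ts => fint (fun i => teval (ts i) v)
  end.

Fixpoint eval (L : language) (U : structure L) (V : Type) (phi : formula L V) :
    (V -> U) -> Prop :=
  match phi with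
  | FEq s t => fun v => teval s v = teval t v
  | FRel r ts => fun v => rint (fun i => teval (ts i) v)
  | FBot => fun _ => False
  | FImp phi psi => fun v => eval phi v -> eval psi v
  | FAll phi => fun v =>
      forall u : U, eval phi (fun o => if o is Some x then v x else u)
  end.

Definition sentence (L : language) := formula L 'I_0.

Definition holds (L : language) (U : structure L) (s : sentence L) : Prop :=
  forall v : 'I_0 -> U, eval s v.

Definition is_model (L : language) (T : set (sentence L)) (U : structure L) :=
  forall s, T s -> holds U s.

Definition entails (L : language) (T : set (sentence L)) (s : sentence L) :=
  forall U : structure L, is_model T U -> holds U s.

Definition complete_theory (L : language) (T : set (sentence L)) : Prop :=
  (exists U : structure L, is_model T U) /\
  forall s, entails T s \/ entails T (FNeg s).

Definition elementary_embedding (L : language) (M U : structure L)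
    (e : M -> U) : Prop :=
  forall (n : nat) (phi : formula L 'I_n) (v : 'I_n -> M),
    eval phi v <-> eval phi (e \o v).

Definition elementary_subset (L : language) (U : structure L) (M : set U) :=
  exists (S : structure L) (e : S -> U),
    elementary_embedding e /\ range e = M.

Definition automorphism (L : language) (U : structure L) (s : U -> U) : Prop :=
  [/\ bijective s,
      forall (f : fsym L) (v : 'I_(far f) -> U), s (fint v) = fint (s \o v)
    & forall (r : rsym L) (v : 'I_(rar r) -> U), rint (s \o v) <-> rint v].

(* phi(x, c), with x indexed by [V] and c a finite tuple of [U]. *)
Record pformula (L : language) (U : structure L) (V : Type) := PForm {
  par_ar : nat;
  pform : formula L (V + 'I_par_ar);
  par : 'I_par_ar -> U }.

Definition tuple_join (X V W : Type) (a : V -> X) (b : W -> X) : V + W -> X :=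
  fun i => match i with inl v => a v | inr w => b w end.

Definition sat (L : language) (U : structure L) (V : Type) (a : V -> U)
    (psi : pformula U V) : Prop :=
  eval (pform psi) (tuple_join a (@par _ _ _ psi)).

Definition pneg (L : language) (U : structure L) (V : Type)
    (psi : pformula U V) : pformula U V :=
  PForm (FNeg (pform psi)) (@par _ _ _ psi).

Definition params_in (L : language) (U : structure L) (V : Type) (A : set U)
    (psi : pformula U V) : Prop :=
  forall i, A (@par _ _ _ psi i).

(* Finite satisfiability in [U], i.e. consistency with the elementary diagram of
   [U]. *)
Definition consistent (L : language) (U : structure L) (V : Type)
    (p : set (pformula U V)) : Prop :=
  forall D : set (pformula U V), finite_set D -> D `<=` p ->
    exists a : V -> U, forall psi, D psi -> sat a psi.

Definition type_over (L : language) (U : structure L) (V : Type) (A : set U)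
    (p : set (pformula U V)) : Prop :=
  p `<=` params_in A /\ consistent p.

Definition complete_type_over (L : language) (U : structure L) (V : Type)
    (A : set U) (p : set (pformula U V)) : Prop :=
  type_over A p /\ forall psi, params_in A psi -> p psi \/ p (pneg psi).

Definition implies (L : language) (U : structure L) (V : Type)
    (p : set (pformula U V)) (psi : pformula U V) : Prop :=
  exists D : set (pformula U V), [/\ finite_set D, D `<=` p &
    forall a : V -> U, (forall chi, D chi -> sat a chi) -> sat a psi].

Definition same_type (L : language) (U : structure L) (V : Type) (A : set U)
    (a b : V -> U) : Prop :=
  forall psi : pformula U V, params_in A psi -> sat a psi <-> sat b psi.

Definition card_lt (X Y : Type) (A : set X) (B : set Y) : Prop :=
  (A #<= B) /\ ~ (B #<= A).

(* The cardinal kappa bounding "small" is |K|. *)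
Definition small (K X : Type) (A : set X) : Prop := card_lt A [set: K].

Definition strong_limit (K : Type) : Prop :=
  small K [set: nat] /\
  forall A : set K, small K A -> small K [set B : set K | B `<=` A].

Definition saturated (L : language) (K : Type) (U : structure L) : Prop :=
  forall (n : nat) (A : set U) (p : set (pformula U 'I_n)),
    small K A -> type_over A p -> exists a, forall psi, p psi -> sat a psi.

Definition partial_elementary (L : language) (U : structure L) (A : set U)
    (g : U -> U) : Prop :=
  forall (n : nat) (phi : formula L 'I_n) (v : 'I_n -> U),
    (forall i, A (v i)) -> eval phi v <-> eval phi (g \o v).

Definition strongly_homogeneous (L : language) (K : Type) (U : structure L) :=
  forall (A : set U) (g : U -> U), small K A -> partial_elementary A g ->
    exists s : U -> U, automorphism s /\ forall x, A x -> s x = g x.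

(* kappa-saturated and strongly kappa-homogeneous for a strong limit
   kappa > |T| = |L| + aleph_0. *)
Definition monster (L : language) (T : set (sentence L)) (K : Type)
    (U : structure L) : Prop :=
  [/\ is_model T U,
      [/\ strong_limit K, small K [set: fsym L] & small K [set: rsym L]],
      saturated K U
    & strongly_homogeneous K U].

Definition NIP (L : language) (U : structure L) (n m : nat)
    (phi : formula L ('I_n + 'I_m)) : Prop :=
  ~ exists (a : nat -> 'I_n -> U) (b : set nat -> 'I_m -> U),
      forall (i : nat) (S : set nat), eval phi (tuple_join (a i) (b S)) <-> S i.

(* Counted by indices, so that a constant sequence phi, phi, ... is
   k-inconsistent only if phi itself is inconsistent. *)
Definition k_inconsistent (L : language) (U : structure L) (V : Type) (k : nat)
    (s : nat -> pformula U V) : Prop :=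
  forall i : 'I_k -> nat, injective i ->
    ~ exists a : V -> U, forall j, sat a (s (i j)).

Definition formula_divides (L : language) (U : structure L) (V : Type)
    (A : set U) (psi : pformula U V) : Prop :=
  exists (k : nat) (c : nat -> 'I_(par_ar psi) -> U),
    (forall i, same_type A (c i) (@par _ _ _ psi)) /\
    k_inconsistent k (fun i => PForm (pform psi) (c i)).

Definition type_divides (L : language) (U : structure L) (V : Type)
    (A : set U) (p : set (pformula U V)) : Prop :=
  exists psi, implies p psi /\ formula_divides A psi.

(* The property of T = Th(U), read in the monster [U]: the models of T are the
   small elementary substructures of [U], and then M `<=` N says M \preceq N. *)
Definition dependent_dividing (L : language) (K : Type) (U : structure L) :=
  forall (M N : set U), small K M -> small K N ->
    elementary_subset M -> elementary_subset N -> M `<=` N ->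
  forall (n : nat) (p : set (pformula U 'I_n)),
    complete_type_over N p -> type_divides M p ->
  exists (m : nat) (phi : formula L ('I_n + 'I_m)) (c : 'I_m -> U),
    [/\ NIP U phi, forall i, N (c i), p (PForm phi c)
      & formula_divides M (PForm phi c)].

(* There is an inp-pattern in p with rows indexed by X, hence of depth |X|. The
   data outside X are irrelevant. *)
Definition inp_pattern (L : language) (K : Type) (U : structure L) (n : nat)
    (p : set (pformula U 'I_n)) (X : set K) : Prop :=
  small K X /\
  exists (m : K -> nat) (phi : forall al, formula L ('I_n + 'I_(m al)))
         (b : forall al, nat -> 'I_(m al) -> U) (k : K -> nat),
    (forall al, X al ->
       k_inconsistent (k al) (fun i => PForm (phi al) (b al i))) /\
    (forall f : K -> nat,
       consistent ([set PForm (phi al) (b al (f al)) | al in X] `|` p)).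

(* The values of bdn: [Card X] is |X| and [CardMinus X] is |X|_-. *)
Variant card_star (K : Type) := Card of set K | CardMinus of set K.

Definition is_bdn (L : language) (K : Type) (U : structure L) (n : nat)
    (p : set (pformula U 'I_n)) (v : card_star K) : Prop :=
  match v with
  | Card X =>
      inp_pattern p X /\ (forall Y : set K, inp_pattern p Y -> Y #<= X)
  | CardMinus X =>
      [/\ forall Y : set K, inp_pattern p Y -> Y #<= X,
          forall Z : set K,
            (forall Y : set K, inp_pattern p Y -> Y #<= Z) -> X #<= Z
        & ~ inp_pattern p X]
  end.

(* kappa_- lies above every cardinal < kappa, and below kappa. *)
Definition card_star_ge (K : Type) (v : card_star K) (k : nat) : Prop :=
  match v with
  | Card X => `I_k #<= X
  | CardMinus X => card_lt `I_k X
  end.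

Definition bdn_ge (L : language) (K : Type) (U : structure L) (n : nat)
    (p : set (pformula U 'I_n)) (k : nat) : Prop :=
  exists v : card_star K, is_bdn p v /\ card_star_ge v k.

Definition indiscernible (L : language) (U : structure L) (m : nat)
    (C : set U) (d : Order.disp_t) (J : orderType d)
    (I : J -> 'I_m -> U) : Prop :=
  infinite_set [set: J] /\
  forall (l : nat) (i j : 'I_l -> J),
    {homo i : s t / (s < t)%N >-> (s < t)%O} ->
    {homo j : s t / (s < t)%N >-> (s < t)%O} ->
    same_type C (fun st : 'I_l * 'I_m => I (i st.1) st.2)
                (fun st : 'I_l * 'I_m => I (j st.1) st.2).

Definition phi_instances (L : language) (U : structure L) (n m : nat)
    (phi : formula L ('I_n + 'I_m)) (A : set ('I_m -> U)) :
    set (pformula U 'I_n) :=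
  [set PForm phi b | b in A] `|` [set PForm (FNeg phi) b | b in A].

Definition complete_phi_type (L : language) (U : structure L) (n m : nat)
    (phi : formula L ('I_n + 'I_m)) (A : set ('I_m -> U))
    (q : set (pformula U 'I_n)) : Prop :=
  [/\ q `<=` phi_instances phi A, consistent q
    & forall q', q' `<=` phi_instances phi A -> consistent q' ->
        q `<=` q' -> q' = q].

Definition phi_types (L : language) (U : structure L) (n m : nat)
    (p : set (pformula U 'I_n)) (phi : formula L ('I_n + 'I_m))
    (A : set ('I_m -> U)) : set (set (pformula U 'I_n)) :=
  [set q | complete_phi_type phi A q /\ consistent (q `|` p)].

(* Here |A| = N is written A #= `I_N. The infimum is +oo if there is no such
   r. *)
Definition vc_dual_density (R : realType) (L : language) (U : structure L)
    (n m : nat) (p : set (pformula U 'I_n)) (phi : formula L ('I_n + 'I_m))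
    (E : set ('I_m -> U)) : \bar R :=
  ereal_inf [set r%:E | r in [set r : R | 0 <= r /\
    exists f : nat -> R,
      [/\ forall N, 0 <= f N,
          f =O_\oo (fun N => N%:R `^ r)
        & forall (A : set ('I_m -> U)) (N : nat), A `<=` E -> A #= `I_N ->
            exists S : nat, phi_types p phi A #= `I_S /\ S%:R <= f N]]].

(* Main.v *)
From mathcomp Require Import all_boot all_order all_algebra.
From mathcomp Require Import all_classical all_reals all_analysis.
From mathcomp Require Import zify.
Require Import Defs.

Set Implicit Arguments.
Unset Strict Implicit.
Unset Printing Implicit Defensive.

Import Order.TTheory GRing.Theory Num.Theory.
Import numFieldNormedType.Exports.

Local Open Scope classical_set_scope.
Local Open Scope card_scope.

(** The implication from (2) to (3) is [k - 1 < k]; the other two are proved as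
follows.

From (1) to (2). Let [phi_al(x, b_(al, i))], for [al < k], be the rows of an
inp-pattern in [p]. Let [F] be a nonprincipal ultrafilter on [nat], and [M] a
small countably saturated elementary submodel containing [C] and the rows. The
ultrapower of [M] by the [k]-fold product of [F] embeds in the monster over [M],
and contains the limits [beta_al] of the rows. Let [a] realize [p] and satisfy
all the [phi_al(x, beta_al)]. The elements of the ultrapower that depend on the
coordinate [al] only form an elementary submodel [N_al] containing [beta_al], and
the type of [a] over [N_al] divides over [M] because of [phi_al(x, beta_al)]:
every formula over [M] true of [beta_al] holds at infinitely many entries of the
row ([limit_divides]). By dependent dividing, the type of [a] over [N_al]
contains a dependent formula [psi_al(x, d_al)] that divides over [M], and [d_al]
is again the limit of a sequence in [M].

The central point is [dividing_limit]: if [psi] is dependent and [psi(x, d)]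
divides over [M], where [d] is the limit of a sequence [delta] in [M], then
boundedly many instances [psi(x, delta_i)], taken along [F], are already
inconsistent. It is a form of Kim's lemma. The type of [d] is finitely
satisfiable in [M], and countable saturation of [M] lets countable
configurations around [delta] be moved into [M], as for a strict Morley sequence; if the
conclusion failed, one would build an array with inconsistent rows and
consistent paths, which the Sauer-Shelah lemma forbids for a dependent formula.
Consequently the sequences in [M] with limits [d_al] give an inp-pattern of
dependent formulas in [p] ([dependent_array]).

The columns of this pattern are turned into one [C]-indiscernible sequence, and
[phi(x, y)] is the disjunction of the [psi_al(x, y_al)], which is dependent. A
realization of [p] on the path [f] has a [phi]-trace on the first [N] terms that
contains the values of [f] and has bounded size. There are [N ^ k] paths, hence
at least a fixed multiple of [N ^ k] [phi]-types, and the density is at least [k]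
([density_of_array]).

From (3) to (1). The [phi]-type of a realization of [p] over [N] terms of the
sequence, listed in increasing order, is a Boolean word of length [N]. Only
[O(N ^ (k - 1))] words have fewer than [k] disjoint pairs of adjacent different
letters. If the density exceeds [k - 1], some realization of [p] therefore
separates the members of [k] disjoint pairs of terms ([separated_pairs]). By
indiscernibility, every finite part of [p] has realizations that do so for any
prescribed [k] successive pairs, whereas a dependent formula bounds the number of
disjoint pairs that one element separates ([alternation_bound]). Pairs cut out
of [k] successive blocks are then the rows of an inp-pattern for the formula
saying that [phi(x, y_0)] and [phi(x, y_1)] are not equivalent.

Formulas are replaced throughout by the relations that they define, and every
infinite configuration is obtained from [compactness], which realizes finitely
satisfiable families of relations in any small number of variables. *)

(** * Renaming, finite support and definable relations *)

Fixpoint trename (L : language) (V W : Type) (g : V -> W) (t : term L V) :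
    term L W :=
  match t with
  | Var x => @Var L W (g x)
  | App f ts => App (fun i => trename g (ts i))
  end.

Fixpoint frename (L : language) (V W : Type) (g : V -> W) (phi : formula L V)
    {struct phi} : formula L W :=
  match phi with
  | FEq s t => FEq (trename g s) (trename g t)
  | FRel r ts => FRel (fun i => trename g (ts i))
  | FBot => FBot
  | FImp a b => FImp (frename g a) (frename g b)
  | FAll a => FAll (frename (omap g) a)
  end.

Definition ocons (V X : Type) (x : X) (v : V -> X) : option V -> X :=
  fun o => if o is Some y then v y else x.

Section Definability.
Context (L : language) (U : structure L).

Lemma teval_rename (V W : Type) (g : V -> W) (t : term L V) (v : W -> U) :
  teval (trename g t) v = teval t (v \o g).
Proof.
elim: t => [x|f ts IH] //=.
by congr fint; apply: funext => i; exact: IH.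
Qed.

Lemma eval_rename (V W : Type) (g : V -> W) (phi : formula L V) (v : W -> U) :
  eval (frename g phi) v = eval phi (v \o g).
Proof.
elim: phi W g v => {V} [V s t|V r ts|V|V a IHa b IHb|V a IHa] W g v //=.
- by rewrite !teval_rename.
- by congr rint; apply: funext => i; exact: teval_rename.
- by rewrite IHa IHb.
- apply: eq_forall => u; rewrite IHa; congr eval.
  by apply: funext => -[].
Qed.

Definition agree (X V : Type) (s : seq {classic V}) (v v' : V -> X) : Prop :=
  forall x : {classic V}, x \in s -> v x = v' x.

Lemma agree_cat (X V : Type) (s1 s2 : seq {classic V}) (v v' : V -> X) :
  agree (s1 ++ s2) v v' -> agree s1 v v' /\ agree s2 v v'.
Proof.
by move=> H; split=> x xs; apply: H; rewrite mem_cat xs ?orbT.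
Qed.

Lemma agree_sym (X V : Type) (s : seq {classic V}) (v v' : V -> X) :
  agree s v v' -> agree s v' v.
Proof. by move=> H x xs; rewrite H. Qed.

Lemma agree_flatten (X V : Type) (I : finType) (s : I -> seq {classic V})
    (v v' : V -> X) (i : I) :
  agree (flatten [seq s i | i : I]) v v' -> agree (s i) v v'.
Proof.
by move=> H x xs; apply: H; apply/flattenP; exists (s i) => //; apply: map_f;
  rewrite mem_enum.
Qed.

Lemma term_support (V : Type) (t : term L V) :
  exists s, forall v v' : V -> U, agree s v v' -> teval t v = teval t v'.
Proof.
elim: t => [x|f ts IH].
  by exists [:: (x : {classic V})] => v v' /(_ x); rewrite mem_head; exact.
have [s hs] := choice IH.
exists (flatten [seq s i | i : 'I_(far f)]) => v v' H /=.
by congr fint; apply: funext => i; apply: hs; exact: (agree_flatten H).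
Qed.

Lemma formula_support (V : Type) (phi : formula L V) :
  exists s, forall v v' : V -> U, agree s v v' -> eval phi v -> eval phi v'.
Proof.
elim: phi => {V} [V t t'|V r ts|V|V a [s hs] b [s' hs']|V a [s hs]].
- have [s hs] := term_support t; have [s' hs'] := term_support t'.
  exists (s ++ s') => v v' /agree_cat[H H'] /=.
  by rewrite (hs _ _ H) (hs' _ _ H').
- have [s hs] := choice (fun i => term_support (ts i)).
  exists (flatten [seq s i | i : 'I_(rar r)]) => v v' H /=.
  have -> // : (fun i => teval (ts i) v) = (fun i => teval (ts i) v').
  by apply: funext => i; apply: hs; exact: (agree_flatten H).
- by exists [::].
- exists (s ++ s') => v v' /agree_cat[H H'] /= ab av'.
  by apply: hs' H' (ab _); apply: hs av'; exact: agree_sym.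
- exists (pmap (fun o : {classic option V} => (o : option V) : option {classic V}) s).
  move=> v v' H /= av u; apply: hs (av u) => -[x xs|//].
  by apply: H; rewrite mem_pmap; apply/mapP; exists (Some x).
Qed.

Definition definable (V : Type) (P : (V -> U) -> Prop) : Prop :=
  exists phi : formula L V, forall v, eval phi v <-> P v.

Lemma definable_ext (V : Type) (P Q : (V -> U) -> Prop) :
  definable P -> (forall v, P v <-> Q v) -> definable Q.
Proof. by move=> [phi h] PQ; exists phi => v; rewrite h. Qed.

Lemma definable_support (V : Type) (P : (V -> U) -> Prop) : definable P ->
  exists s, forall v v' : V -> U, agree s v v' -> P v -> P v'.
Proof.
move=> [phi h]; have [s hs] := formula_support phi.
by exists s => v v' /hs; rewrite !h.
Qed.

Lemma definable_eval (V : Type) (phi : formula L V) : definable (@eval L U V phi).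
Proof. by exists phi. Qed.

Lemma definable_imp (V : Type) (P Q : (V -> U) -> Prop) :
  definable P -> definable Q -> definable (fun v => P v -> Q v).
Proof.
by move=> [a ha] [b hb]; exists (FImp a b) => v /=; rewrite ha hb.
Qed.

Lemma definable_const (V : Type) (b : Prop) : definable (fun _ : V -> U => b).
Proof.
have [hb|hb] := pselect b.
  by exists (FImp FBot FBot) => v /=; tauto.
by exists FBot => v /=; tauto.
Qed.

Lemma definable_not (V : Type) (P : (V -> U) -> Prop) :
  definable P -> definable (fun v => ~ P v).
Proof. by move=> dP; apply: definable_imp => //; exact: definable_const. Qed.

Lemma definable_and (V : Type) (P Q : (V -> U) -> Prop) :
  definable P -> definable Q -> definable (fun v => P v /\ Q v).
Proof.
move=> dP dQ.
apply: (definable_ext (definable_not (definable_imp dP (definable_not dQ)))) => v.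
split=> [H|[p q] /(_ p)//].
by apply: contrapT => nPQ; apply: H => p q; apply: nPQ.
Qed.

Lemma definable_iff (V : Type) (P Q : (V -> U) -> Prop) :
  definable P -> definable Q -> definable (fun v => P v <-> Q v).
Proof.
by move=> dP dQ; rewrite /iff; apply: definable_and; apply: definable_imp.
Qed.

Lemma definable_eq (V : Type) (x y : V) : definable (fun v : V -> U => v x = v y).
Proof. by exists (FEq (@Var L V x) (@Var L V y)). Qed.

Lemma definable_rename (V W : Type) (g : V -> W) (P : (V -> U) -> Prop) :
  definable P -> definable (fun v : W -> U => P (v \o g)).
Proof. by move=> [phi h]; exists (frename g phi) => v; rewrite eval_rename h. Qed.

Lemma definable_all (V : Type) (P : (option V -> U) -> Prop) :
  definable P -> definable (fun v => forall u, P (ocons u v)).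
Proof.
move=> [phi h]; exists (FAll phi) => v /=.
by split=> H u; have := H u; rewrite h.
Qed.

Lemma definable_ex (V : Type) (P : (option V -> U) -> Prop) :
  definable P -> definable (fun v => exists u, P (ocons u v)).
Proof.
move=> dP.
apply: (definable_ext (definable_not (definable_all (definable_not dP)))) => v.
by rewrite -existsNP; split=> -[u] => [/contrapT|]; exists u.
Qed.

Lemma definable_allseq (V : Type) (I : eqType) (s : seq I)
    (P : I -> (V -> U) -> Prop) :
  (forall i, i \in s -> definable (P i)) ->
  definable (fun v => forall i, i \in s -> P i v).
Proof.
elim: s => [|i s IH] H.
  by apply: (definable_ext (definable_const V True)) => v; split.
have di : definable (P i) by apply: H; rewrite mem_head.
have ds : definable (fun v => forall j, j \in s -> P j v).
  by apply: IH => j js; apply: H; rewrite inE js orbT.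
apply: (definable_ext (definable_and di ds)) => v; split=> [[Pi Ps] j|Ps].
  by rewrite inE => /orP[/eqP->//|]; exact: Ps.
by split=> [|j js]; apply: Ps; rewrite inE ?eqxx// js orbT.
Qed.

Lemma definable_allfin (V : Type) (I : finType) (P : I -> (V -> U) -> Prop) :
  (forall i, definable (P i)) -> definable (fun v => forall i, P i v).
Proof.
move=> H; apply: (definable_ext (@definable_allseq V I (enum I) P (fun i _ => H i))) => v.
by split=> Ps i; have := Ps i; rewrite ?mem_enum//; exact.
Qed.

Lemma definable_exfin (V : Type) (I : finType) (P : I -> (V -> U) -> Prop) :
  (forall i, definable (P i)) -> definable (fun v => exists i, P i v).
Proof.
move=> H; have dN i := definable_not (H i).
apply: (definable_ext (definable_not (definable_allfin dN))) => v.
by rewrite -existsNP; split=> -[i] => [/contrapT|]; exists i.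
Qed.

Lemma definable_exI (n : nat) (W : Type) (P : ('I_n + W -> U) -> Prop) :
  definable P -> definable (fun w => exists a, P (tuple_join a w)).
Proof.
elim: n W P => [|n IH] W P dP.
  pose g (x : 'I_0 + W) : W := match x with
    | inl i => match (let: Ordinal _ h := i in notF (h : false)) with end | inr y => y end.
  apply: (definable_ext (definable_rename g dP)) => w.
  have E (a : 'I_0 -> U) : tuple_join a w = w \o g.
    by apply: funext => -[[]|].
  split=> [H|[a]]; last by rewrite E.
  by exists (fun i => w (g (inl i))); rewrite E.
pose g (x : 'I_n.+1 + W) : option ('I_n + W) := match x with
  | inl i => if unlift ord0 i is Some j then Some (inl j) else None
  | inr y => Some (inr y) end.
have /definable_ex dQ := definable_rename g dP.
pose r (x : 'I_n + W) := x.
apply: (definable_ext (IH _ _ dQ)) => w; split=> [[a [u H]]|[a H]].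
  exists (fun i => if unlift ord0 i is Some j then a j else u).
  suff -> : tuple_join (fun i => if unlift ord0 i is Some j then a j else u) w
     = ocons u (tuple_join a w) \o g by [].
  by apply: funext => -[i|y] //=; case: (unlift ord0 i).
exists (fun j => a (lift ord0 j)), (a ord0).
suff -> : ocons (a ord0) (tuple_join (fun j => a (lift ord0 j)) w) \o g
  = tuple_join a w by [].
by apply: funext => -[i|y] //=; case: unliftP => [j ->|->].
Qed.

(** Only the finitely many variables of [X] in the support of [P] matter, so
quantifying over an infinite block of variables is still first-order. *)
Lemma definable_exV (X W : Type) (P : (X + W -> U) -> Prop) :
  definable P -> definable (fun w => exists a, P (tuple_join a w)).
Proof.
move=> dP; have [s hs] := definable_support dP.
have [x0|nX] := pselect (inhabited X); last first.
  pose g (x : X + W) : W := match x with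
    | inl i => match nX (inhabits i) with end | inr y => y end.
  apply: (definable_ext (definable_rename g dP)) => w.
  have E (a : X -> U) : tuple_join a w = w \o g.
    by apply: funext => -[i|//]; case: (nX (inhabits i)).
  split=> [H|[a]]; last by rewrite E.
  by exists (fun i => w (g (inl i))); rewrite E.
have {}x0 : X := inhabited_witness x0.
pose t : seq {classic X} := x0 :: pmap (fun z : {classic X + W} =>
   if (z : X + W) is inl x then Some (x : {classic X}) else None) s.
pose n := (size t).-1.
pose ind (x : X) : 'I_n.+1 := inord (index (x : {classic X}) t).
pose val (i : 'I_n.+1) : X := nth (x0 : {classic X}) t i.
have valK (x : X) : (x : {classic X}) \in t -> val (ind x) = x.
  move=> xt; rewrite /val /ind inordK ?nth_index//.
  by move: xt; rewrite -index_mem.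
pose r (z : X + W) : 'I_n.+1 + W := match z with inl x => inl (ind x) | inr y => inr y end.
apply: (definable_ext (definable_exI (definable_rename r dP))) => w.
split=> -[a H].
  exists (a \o ind).
  have -> // : tuple_join (a \o ind) w = tuple_join a w \o r.
  by apply: funext => -[].
exists (a \o val); apply: hs H => -[x|y] //= xs.
rewrite valK// inE mem_pmap; apply/orP; right.
by apply/mapP; exists (inl x).
Qed.

End Definability.

(** * Relations definable with parameters *)

Section DefinableOver.
Context (L : language) (U : structure L).

(** Parameters are extra variables, evaluated at themselves; the closure
properties are then those of [definable]. *)
Definition pdefinable (A : set U) (V : Type) (P : (V -> U) -> Prop) : Prop :=
  exists Q : (V + {x | A x} -> U) -> Prop,
    definable Q /\ forall a, P a <-> Q (tuple_join a sval).

Section Closure.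
Context (A : set U) (V : Type).
Implicit Types P Q : (V -> U) -> Prop.

Lemma pdefinable_ext P Q :
  pdefinable A P -> (forall v, P v <-> Q v) -> pdefinable A Q.
Proof. by move=> [R [dR h]] PQ; exists R; split=> // a; rewrite -PQ h. Qed.

Lemma definable_pdefinable P : definable P -> pdefinable A P.
Proof.
move=> dP; exists (fun v => P (v \o inl)); split=> //.
exact: definable_rename.
Qed.

Lemma pdefinable_const (b : Prop) : pdefinable A (fun _ : V -> U => b).
Proof. exact/definable_pdefinable/definable_const. Qed.

Lemma pdefinable_not P : pdefinable A P -> pdefinable A (fun v => ~ P v).
Proof.
move=> [R [dR h]]; exists (fun v => ~ R v).
by split=> [|a]; [exact: definable_not|rewrite h].
Qed.

Lemma pdefinable_and P Q :
  pdefinable A P -> pdefinable A Q -> pdefinable A (fun v => P v /\ Q v).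
Proof.
move=> [R [dR h]] [R' [dR' h']]; exists (fun v => R v /\ R' v).
by split=> [|a]; [exact: definable_and|rewrite h h'].
Qed.

Lemma pdefinable_allseq (I : eqType) (s : seq I) (P : I -> (V -> U) -> Prop) :
  (forall i, i \in s -> pdefinable A (P i)) ->
  pdefinable A (fun v => forall i, i \in s -> P i v).
Proof.
elim: s => [|i s IH] H.
  by apply: (pdefinable_ext (pdefinable_const True)) => v; split.
have di : pdefinable A (P i) by apply: H; rewrite mem_head.
have ds : pdefinable A (fun v => forall j, j \in s -> P j v).
  by apply: IH => j js; apply: H; rewrite inE js orbT.
apply: (pdefinable_ext (pdefinable_and di ds)) => v; split=> [[Pi Ps] j|Ps].
  by rewrite inE => /orP[/eqP->//|]; exact: Ps.
by split=> [|j js]; apply: Ps; rewrite inE ?eqxx// js orbT.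
Qed.

Lemma pdefinable_allfin (I : finType) (P : I -> (V -> U) -> Prop) :
  (forall i, pdefinable A (P i)) -> pdefinable A (fun v => forall i, P i v).
Proof.
move=> H.
apply: (pdefinable_ext (@pdefinable_allseq I (enum I) P (fun i _ => H i))) => v.
by split=> Ps i; have := Ps i; rewrite ?mem_enum//; exact.
Qed.

End Closure.

Lemma pdefinable_sub (A B : set U) (V : Type) (P : (V -> U) -> Prop) :
  A `<=` B -> pdefinable A P -> pdefinable B P.
Proof.
move=> AB [R [dR h]].
pose r (x : V + {x | A x}) : V + {x | B x} :=
  match x with inl v => inl v | inr c => inr (exist B (sval c) (AB _ (svalP c))) end.
exists (fun v => R (v \o r)); split; first exact: definable_rename.
by move=> a; rewrite h; have -> : tuple_join a sval = tuple_join a sval \o r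
  by apply: funext => -[].
Qed.

Lemma pdefinable_bind (A : set U) (V W : Type) (r : V -> W + {x | A x})
    (P : (V -> U) -> Prop) :
  pdefinable A P -> pdefinable A (fun b : W -> U => P (tuple_join b sval \o r)).
Proof.
move=> [R [dR h]].
pose r' (x : V + {x | A x}) : W + {x | A x} :=
  match x with inl v => r v | inr c => inr c end.
exists (fun v => R (v \o r')); split; first exact: definable_rename.
move=> a; rewrite h.
by have -> : tuple_join (tuple_join a sval \o r) sval = tuple_join a sval \o r'
  by apply: funext => -[].
Qed.

Lemma pdefinable_rename (A : set U) (V W : Type) (g : V -> W)
    (P : (V -> U) -> Prop) :
  pdefinable A P -> pdefinable A (fun b : W -> U => P (b \o g)).
Proof.
move=> dP; apply: (pdefinable_ext (pdefinable_bind (fun v => inl (g v)) dP)).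
by [].
Qed.

Lemma pdefinable_subst (A : set U) (V W : Type) (c : W -> U)
    (P : (V + W -> U) -> Prop) : (forall i, A (c i)) ->
  pdefinable A P -> pdefinable A (fun b : V -> U => P (tuple_join b c)).
Proof.
move=> Ac dP.
pose r (x : V + W) : V + {x | A x} :=
  match x with inl v => inl v | inr i => inr (exist A (c i) (Ac i)) end.
apply: (pdefinable_ext (pdefinable_bind r dP)) => v.
by have -> : tuple_join v c = tuple_join v sval \o r by apply: funext => -[].
Qed.

Lemma pdefinable_exV (A : set U) (X W : Type) (P : (X + W -> U) -> Prop) :
  pdefinable A P -> pdefinable A (fun w => exists a, P (tuple_join a w)).
Proof.
move=> [R [dR h]].
pose r (x : X + W + {x | A x}) : X + (W + {x | A x}) :=
  match x with
  | inl (inl x) => inl x | inl (inr w) => inr (inl w) | inr c => inr (inr c)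
  end.
exists (fun v => exists a, R (tuple_join a v \o r)).
split; first exact: (definable_exV (definable_rename r dR)).
move=> w; have E (a : X -> U) : tuple_join a (tuple_join w sval) \o r =
  tuple_join (tuple_join a w) sval by apply: funext => -[[]|].
by split=> -[a H]; exists a; move: H; rewrite h E.
Qed.

Lemma pdefinable_support (A : set U) (V : Type) (P : (V -> U) -> Prop) :
  pdefinable A P ->
  exists s, forall v v' : V -> U, agree s v v' -> P v -> P v'.
Proof.
move=> [R [dR h]]; have [s hs] := definable_support dR.
exists (pmap (fun z : {classic V + {x | A x}} =>
   if (z : V + {x | A x}) is inl x then Some (x : {classic V}) else None) s).
move=> v v' vv'; rewrite !h; apply: hs => -[x|//] xs /=.
by apply: vv'; rewrite mem_pmap; apply/mapP; exists (inl x).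
Qed.

Lemma sat_pdefinable (A : set U) (V : Type) (psi : pformula U V) :
  params_in A psi -> pdefinable A (fun a => sat a psi).
Proof.
move=> Apsi; apply: (@pdefinable_subst A V _ (@par _ _ _ psi) _ Apsi).
exact/definable_pdefinable/definable_eval.
Qed.

Lemma pdefinable_sat (A : set U) (V : Type) (P : (V -> U) -> Prop) :
  pdefinable A P ->
  exists psi : pformula U V, params_in A psi /\ forall a, sat a psi <-> P a.
Proof.
move=> [R [[phi hphi] h]].
have [s hs] := formula_support U phi.
have [[c0]|nA] := pselect (inhabited {x | A x}); last first.
  pose r (x : V + {x | A x}) : V + 'I_0 := match x with
    | inl v => inl v | inr c => match nA (inhabits c) with end end.
  exists (PForm (frename r phi) (fun i : 'I_0 => False_rect U (notF (ltn_ord i)))).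
  split=> [[]//|a]; rewrite /sat/= eval_rename h -hphi.
  set v := _ \o r; have -> // : v = tuple_join a sval.
  by apply: funext => -[//|c]; case: (nA (inhabits c)).
pose t : seq {classic {x | A x}} := c0 :: pmap (fun z : {classic V + {x | A x}} =>
   if (z : V + {x | A x}) is inr c then Some (c : {classic {x | A x}}) else None) s.
pose r (x : V + {x | A x}) : V + 'I_(size t).-1.+1 := match x with
  | inl v => inl v | inr c => inr (inord (index (c : {classic {x | A x}}) t)) end.
pose p (i : 'I_(size t).-1.+1) : U := sval (nth (c0 : {classic {x | A x}}) t i).
exists (PForm (frename r phi) p); split=> [i|a]; first exact: svalP.
rewrite /sat/= eval_rename h -hphi.
have E : agree s (tuple_join a p \o r) (tuple_join a sval).
  move=> -[//|c] cs /=; rewrite /p; congr sval.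
  have ct : (c : {classic {x | A x}}) \in t.
    by rewrite inE mem_pmap; apply/orP; right; apply/mapP; exists (inr c).
  rewrite inordK ?nth_index//.
  by move: ct; rewrite -index_mem.
by split; apply: hs => //; exact: agree_sym.
Qed.

Lemma same_type_pdefinable (A : set U) (V : Type) (a b : V -> U)
    (P : (V -> U) -> Prop) :
  same_type A a b -> pdefinable A P -> P a <-> P b.
Proof.
move=> ab /pdefinable_sat[psi [Apsi h]].
by rewrite -!h; exact: ab.
Qed.

End DefinableOver.

(** * Small sets *)

Lemma card_le_inj (X Y : Type) (A : set X) (B : set Y) (f : X -> Y) :
  (forall x, A x -> B (f x)) ->
  (forall x y, A x -> A y -> f x = f y -> x = y) -> A #<= B.
Proof.
move=> fAB finj.
have : $|{injfun A >-> B}|.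
  apply/injfunPex; exists f => // x y; rewrite !inE; exact: finj.
by move=> [g]; exact: inj_card_le.
Qed.

Lemma card_le_exinj (X Y : Type) (A : set X) (B : set Y) : A #<= B ->
  exists f : {x | A x} -> Y, injective f /\ forall x, B (f x).
Proof.
move=> /card_leP[f].
exists (fun x => val (f (SigSub (mem_set (svalP x))))); split; last first.
  by move=> x; exact: set_valP.
move=> [x Ax] [y Ay] /= /val_inj.
move=> /(@inj _ _ _ f); rewrite !inE => /(_ Logic.I Logic.I) [].
by move=> xy; exact: eq_exist.
Qed.

Lemma card_sigr (X : Type) (A : set X) : [set: {x | A x}] #<= A.
Proof.
apply: (@card_le_inj _ _ _ _ sval) => [x _|[x Ax] [y Ay] _ _ /= xy].
  exact: svalP.
exact: eq_exist.
Qed.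

Lemma card_sigl (X : Type) (A : set X) : A #<= [set: {x | A x}].
Proof.
have [[a0]|nA] := pselect (inhabited {x | A x}).
  pose f (x : X) : {x | A x} := if pselect (A x) is left h then exist A x h else a0.
  apply: (@card_le_inj _ _ _ _ f) => // x y Ax Ay; rewrite /f.
  by case: pselect => // h; case: pselect => // h' [].
have -> : A = set0 by apply/seteqP; split=> // x Ax; case: nA; constructor; exists x.
exact: card_ge0.
Qed.

(** On a maximal set of choice functions that every projection maps
injectively, some projection is onto: otherwise a function avoiding the images
of all the projections could be added. *)
Lemma minimal_cardinal (I : Type) (Z : I -> Type) : inhabited I ->
  exists i, forall j, [set: Z i] #<= [set: Z j].
Proof.
move=> [i0].
pose P (S : set (forall i, Z i)) : Prop :=
  forall i x y, S x -> S y -> x i = y i -> x = y.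
have [F FP Ftot|S [PS maxS]] := @Zorn_bigcup _ P.
  move=> i x y [A FA Ax] [B FB By]; have [AB|BA] := Ftot _ _ FA FB.
    exact: (FP _ FB) (AB _ Ax) By.
  exact: (FP _ FA) Ax (BA _ By).
have [i hi] : exists i, forall z, exists2 x, S x & x i = z.
  apply: contrapT => /forallNP H.
  have H' i : exists z, forall x, S x -> x i <> z.
    have /existsNP[z hz] := H i; exists z => x Sx xz; apply: hz; exists x => //.
  pose z i := projT1 (cid (H' i)).
  have hz i x : S x -> x i <> z i by exact: (projT2 (cid (H' i))).
  apply: (maxS (S `|` [set z])).
    by split=> [x Sx|sub]; [left|have := hz i0 z (sub z (or_intror erefl)); exact].
  move=> i x y [Sx|->] [Sy|->] //; first exact: PS.
    by move=> /(hz _ _ Sx).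
  by move=> /esym /(hz _ _ Sy).
exists i => j.
have hi' z : exists x, S x /\ x i = z by have [x] := hi z; exists x.
have [f hf] := choice hi'.
apply: (@card_le_inj _ _ _ _ (fun z => f z j)) => // x y _ _ E.
rewrite -(hf x).2 -(hf y).2; congr (_ i).
exact: PS (hf x).1 (hf y).1 E.
Qed.

Lemma card_leT_inj (X Y : Type) :
  [set: X] #<= [set: Y] -> exists f : X -> Y, injective f.
Proof.
move=> /card_le_exinj[f [finj _]]; exists (fun x => f (exist _ x Logic.I)).
by move=> x y /finj [].
Qed.

Section Small.
Context (K : Type).

Lemma small_card_le (X Y : Type) (A : set X) (B : set Y) :
  A #<= B -> small K B -> small K A.
Proof.
move=> AB [BK KB]; split; first exact: card_le_trans AB BK.
by move=> KA; apply: KB; exact: card_le_trans KA AB.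
Qed.

Lemma smallT_inj (X Y : Type) (f : X -> Y) :
  injective f -> small K [set: Y] -> small K [set: X].
Proof.
by move=> finj; apply: small_card_le; apply: (@card_le_inj _ _ _ _ f) => // x y _ _ /finj.
Qed.

Lemma small_sig (X : Type) (A : set X) : small K A <-> small K [set: {x | A x}].
Proof. by split; apply: small_card_le; [exact: card_sigr|exact: card_sigl]. Qed.

Lemma small_image (X Y : Type) (f : X -> Y) (A : set Y) :
  small K [set: X] -> (forall y, A y -> exists x, f x = y) -> small K A.
Proof.
move=> sX h; apply/small_sig.
have h' (y : {y | A y}) : exists x, f x = sval y by apply: h; exact: svalP.
have [g hg] := choice h'.
apply: (smallT_inj _ sX (f := g)) => y y' E.
have : sval y = sval y' by rewrite -!hg E.
by case: y {E} => y Ay; case: y' => y' Ay' /= E; exact: eq_exist.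
Qed.

Hypothesis K_lim : strong_limit K.

Lemma smallT_nat : small K [set: nat]. Proof. by case: K_lim. Qed.

Lemma smallT_count (X : countType) : small K [set: X].
Proof. by apply: (smallT_inj _ smallT_nat (f := @pickle X)); exact: (pcan_inj pickleK). Qed.

Lemma smallT_set (X : Type) : small K [set: X] -> small K [set: set X].
Proof.
move=> sX; have [/card_le_exinj[f [finj _]] _] := sX.
pose g (x : X) := f (exist _ x Logic.I).
have ginj : injective g by move=> x y /finj [].
have sA : small K (range g).
  by apply: (small_image sX (f := g)) => y [x _ <-]; exists x.
apply: small_card_le (K_lim.2 _ sA).
apply: (@card_le_inj _ _ _ _ (fun B => g @` B)) => [B _ _ [x _ <-]|B B' _ _ E].
  by exists x.
apply/seteqP; split=> x Bx.
  have : (g @` B) (g x) by exists x.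
  by rewrite E => -[y B'y /ginj <-].
have : (g @` B') (g x) by exists x.
by rewrite -E => -[y B'y /ginj <-].
Qed.

Lemma card_le_total (X Y : Type) : [set: X] #<= [set: Y] \/ [set: Y] #<= [set: X].
Proof.
have [[] H] := @minimal_cardinal bool (fun b => if b then X else Y) (inhabits true).
  by left; exact: (H false).
by right; exact: (H true).
Qed.

(** Injections into iterated powersets take the place of cardinal arithmetic,
since a strong limit is closed under powersets by definition. *)
Lemma smallT_sum (X Y : Type) :
  small K [set: X] -> small K [set: Y] -> small K [set: X + Y].
Proof.
wlog /card_leT_inj[f finj] : X Y / [set: X] #<= [set: Y].
  move=> H sX sY; have [XY|YX] := card_le_total X Y; first exact: H.
  apply: (smallT_inj _ (H _ _ YX sY sX)
    (f := fun z => match z with inl x => inr x | inr y => inl y end)).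
  by move=> [a|a] [b|b] //= [->].
move=> _ sY; apply: (smallT_inj _ (smallT_set (smallT_set sY)) (f := fun z =>
  match z with inl x => [set set0; [set f x]] | inr y => [set [set y]] end)).
have nz (y : Y) : [set y] <> set0 by move=> /seteqP[/(_ y erefl)].
have s1 (y z : Y) : [set y] = [set z] -> y = z.
  by move=> /seteqP[/(_ y erefl)].
move=> [a|a] [b|b] /= /seteqP[h1 h2].
- by have [/nz//|/s1/finj->] := h1 _ (or_intror erefl).
- by have /esym/nz := h1 _ (or_introl erefl).
- by have /esym/nz := h2 _ (or_introl erefl).
- by have /s1-> := h1 _ erefl.
Qed.

Lemma smallT_prod (X Y : Type) :
  small K [set: X] -> small K [set: Y] -> small K [set: X * Y].
Proof.
move=> sX sY; apply: (smallT_inj _ (smallT_set (smallT_sum sX sY)) (f := fun z =>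
  [set inl z.1; inr z.2])) => -[a b] [c d] /= /seteqP[h _].
have [[->]|//] := h _ (or_introl erefl).
by have [//|[->]] := h _ (or_intror erefl).
Qed.

Lemma smallT_fun (X Y : Type) :
  small K [set: X] -> small K [set: Y] -> small K [set: X -> Y].
Proof.
move=> sX sY; apply: (smallT_inj _ (smallT_set (smallT_prod sX sY)) (f := fun f =>
  [set z | f z.1 = z.2])) => f g /seteqP[h _].
by apply: funext => x; rewrite (h (x, f x) erefl).
Qed.

Lemma small_setU (X : Type) (A B : set X) :
  small K A -> small K B -> small K (A `|` B).
Proof.
move=> /small_sig sA /small_sig sB.
apply: (small_image (smallT_sum sA sB) (f := fun z =>
  match z with inl x => sval x | inr y => sval y end)).
by move=> x [Ax|Bx]; [exists (inl (exist _ x Ax))|exists (inr (exist _ x Bx))].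
Qed.

Lemma small_range (X Y : Type) (f : X -> Y) :
  small K [set: X] -> small K (range f).
Proof. by move=> sX; apply: (small_image sX (f := f)) => y [x _ <-]; exists x. Qed.

End Small.

(** * Countably branching trees and the number of formulas *)

(** Such trees code formulas, and also the elements of the closure of a set
under operations with countably many arguments. *)
Inductive tree (A : Type) : Type :=
| Leaf (a : A)
| Node (a : A) (ch : nat -> tree A).

(** The labels found at the end of the finite paths determine the tree. *)
Fixpoint tree_code (A : Type) (t : tree A) : set (seq nat * A) :=
  match t with
  | Leaf a => [set ([::], a)]
  | Node a ch => [set z | z = ([::], a) \/
      exists i l b, z = (i :: l, b) /\ tree_code (ch i) (l, b)]
  end.

Lemma tree_code_root (A : Type) (t : tree A) : exists a, tree_code t ([::], a).
Proof. by case: t => a => [|ch]; exists a => //; left. Qed.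

Lemma tree_code_inj (A : Type) : injective (@tree_code A).
Proof.
move=> t; elim: t => [a|a ch IH] [b|b ch'] /seteqP[/= h1 h2].
- by case: (h1 ([::], a) erefl) => ->.
- have [c hc] := tree_code_root (ch' 0).
  by have := h2 ([:: 0], c) (or_intror (ex_intro _ 0 (ex_intro _ [::]
    (ex_intro _ c (conj erefl hc))))).
- have [c hc] := tree_code_root (ch 0).
  by have := h1 ([:: 0], c) (or_intror (ex_intro _ 0 (ex_intro _ [::]
    (ex_intro _ c (conj erefl hc))))).
- have -> : a = b by case: (h1 ([::], a) (or_introl erefl)) => [[]|[i [l [c []]]]].
  congr Node; apply: funext => i; apply: IH; apply/seteqP; split=> -[l c] hc.
    have [//|[j [l' [c' [[-> -> ->]]]]] //] := h1 (i :: l, c)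
      (or_intror (ex_intro _ i (ex_intro _ l (ex_intro _ c (conj erefl hc))))).
  have [//|[j [l' [c' [[-> -> ->]]]]] //] := h2 (i :: l, c)
    (or_intror (ex_intro _ i (ex_intro _ l (ex_intro _ c (conj erefl hc))))).
Qed.

Lemma smallT_tree (K A : Type) :
  strong_limit K -> small K [set: A] -> small K [set: tree A].
Proof.
move=> Kl sA; apply: (smallT_inj (@tree_code_inj A)); apply: smallT_set => //.
by apply: smallT_prod => //; exact: smallT_count.
Qed.

Section FormulaCard.
Context (L : language).

Definition symbol : Type := fsym L + (rsym L + nat).
Definition stag (n : nat) : symbol := inr (inr n).
Definition children (n : nat) (t : 'I_n -> tree symbol) (i : nat) : tree symbol :=
  if insub i is Some j then t j else Leaf (stag 0).

Lemma children_inj (n : nat) : injective (@children n).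
Proof.
move=> t t' E; apply: funext => i; have := congr1 (fun c => c (val i)) E.
by rewrite /children valK.
Qed.

Fixpoint term_tree (V : Type) (e : V -> nat) (t : term L V) : tree symbol :=
  match t with
  | Var x => Leaf (stag (e x))
  | App f ts => Node (inl f) (children (fun i => term_tree e (ts i)))
  end.

Fixpoint formula_tree (V : Type) (e : V -> nat) (phi : formula L V)
    {struct phi} : tree symbol :=
  match phi with
  | FEq s t => Node (stag 0)
      (fun i => if i is 0 then term_tree e s else term_tree e t)
  | FRel r ts => Node (inr (inl r)) (children (fun i => term_tree e (ts i)))
  | FBot => Leaf (stag 0)
  | FImp a b => Node (stag 1)
      (fun i => if i is 0 then formula_tree e a else formula_tree e b)
  | FAll a => Node (stag 2)
      (fun=> formula_tree (fun o => if o is Some x then (e x).+1 else 0) a)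
  end.

Lemma term_tree_inj (V : Type) (e : V -> nat) :
  injective e -> injective (term_tree e).
Proof.
move=> einj t; elim: t => [x|f ts IH] [y|g us] //=.
  by move=> [/einj->].
move=> [E]; move: us; rewrite -E => us /children_inj Es.
by congr App; apply: funext => i; apply: IH; exact: (congr1 (fun c => c i) Es).
Qed.

Lemma formula_tree_inj (V : Type) (e : V -> nat) :
  injective e -> injective (formula_tree e).
Proof.
move=> einj phi; elim: phi e einj => {V}
  [V s t|V r ts|V|V a IHa b IHb|V a IHa] e einj [s' t'|r' ts'||a' b'|a'] //=.
- move=> [E]; have /= := congr1 (fun c => c 0) E; have /= := congr1 (fun c => c 1) E.
  by move=> /(term_tree_inj einj)-> /(term_tree_inj einj)->.
- move=> [E]; move: ts'; rewrite -E => ts' /children_inj Es.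
  congr FRel; apply: funext => i; apply: (term_tree_inj einj).
  exact: (congr1 (fun c => c i) Es).
- move=> [E]; have /= := congr1 (fun c => c 0) E; have /= := congr1 (fun c => c 1) E.
  by move=> /(IHb _ einj)-> /(IHa _ einj)->.
- move=> [E]; have /= := congr1 (fun c => c 0) E => /IHa-> //.
  by move=> [x|] [y|] //= [/einj->].
Qed.

Lemma smallT_formula (K : Type) (V : countType) : strong_limit K ->
  small K [set: fsym L] -> small K [set: rsym L] -> small K [set: formula L V].
Proof.
move=> Kl sf sr; apply: (smallT_inj (formula_tree_inj (pcan_inj (@pickleK V)))).
apply: smallT_tree => //; apply: smallT_sum => //; apply: smallT_sum => //.
exact: smallT_nat.
Qed.

End FormulaCard.

(** * Saturation for infinitely many variables *)

Lemma finite_set_seq (T : Type) (D : set T) :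
  finite_set D -> exists s : seq {classic T}, forall x, D x <-> x \in s.
Proof.
move=> fD; have /(@finite_seqP {classic T})[s ->] := fD.
by exists s.
Qed.

Lemma seq_finite_set (T : Type) (s : seq {classic T}) :
  finite_set [set x : T | (x : {classic T}) \in s].
Proof. exact: (@finite_seq {classic T} s). Qed.

Section Saturation.
Context (L : language) (K : Type) (U : structure L).
Hypothesis K_lim : strong_limit K.
Hypothesis U_sat : saturated K U.

Lemma saturated_pdefinable (n : nat) (A : set U) (I : Type)
    (R : I -> ('I_n -> U) -> Prop) :
  small K A -> (forall i, pdefinable A (R i)) ->
  (forall s : seq {classic I}, exists a, forall i : {classic I}, i \in s -> R i a) ->
  exists a, forall i, R i a.
Proof.
move=> sA dR fs.
pose p : set (pformula U 'I_n) :=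
  [set psi | params_in A psi /\ exists i, forall a, sat a psi <-> R i a].
have [|a Ha] := U_sat (p := p) sA.
  split=> [psi []//|D /finite_set_seq[s hs] Dp].
  have [t ht] : exists t : seq {classic I}, forall a,
      (forall i : {classic I}, i \in t -> R i a) ->
      forall psi : {classic pformula U 'I_n}, psi \in s -> sat a psi.
    have {hs}sp (psi : {classic pformula U 'I_n}) : psi \in s -> p psi.
      by move=> ps; apply: Dp; apply/hs.
    elim: s sp => [|psi s IH] sp; first by exists [::].
    have [|t ht] := IH; first by move=> chi cs; apply: sp; rewrite inE cs orbT.
    have [_ [i hi]] := sp psi (mem_head _ _).
    exists ((i : {classic I}) :: t) => a Ha chi; rewrite inE => /orP[/eqP->|].
      by apply/hi; apply: Ha; rewrite mem_head.
    by apply: ht => j jt; apply: Ha; rewrite inE jt orbT.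
  have [a Ha] := fs t; exists a => psi /hs; exact: ht.
exists a => i.
have [psi [Apsi hpsi]] := pdefinable_sat (dR i).
by apply/hpsi; apply: Ha; split=> //; exists i.
Qed.

(** The variables are given values one at a time, keeping the family finitely
satisfiable; Zorn's lemma replaces a transfinite recursion. The value of one
more variable has to satisfy a type in that variable over the previous values,
because the other variables can be quantified away. *)
Theorem compactness (X I : Type) (A : set U) (G : I -> (X -> U) -> Prop) :
  small K [set: X] -> small K A -> (forall i, pdefinable A (G i)) ->
  (forall s : seq {classic I}, exists a, forall i : {classic I}, i \in s -> G i a) ->
  exists a, forall i, G i a.
Proof.
move=> sX sA dG fs.
pose ext (h : X -> option U) (a : X -> U) := forall x u, h x = Some u -> a x = u.
pose good (h : X -> option U) := forall s : seq {classic I},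
  exists a, (forall i : {classic I}, i \in s -> G i a) /\ ext h a.
pose R (h h' : {h | good h}) :=
  `[< forall x u, sval h x = Some u -> sval h' x = Some u >].
have [||h h' /asboolP H /asboolP H'|C Ctot|[h hgood] hmax] :=
    @Zorn {h | good h} R.
- by move=> h; apply/asboolP.
- move=> h1 h2 h3 /asboolP H /asboolP H'; apply/asboolP => x u hx.
  exact/H'/H.
- case: h h' H H' => h hg [h' hg'] /= H H'; apply: eq_exist.
  apply: funext => x; case E : (h x) => [u|]; first by rewrite (H _ _ E).
  by case E' : (h' x) => [u|//]; rewrite (H' _ _ E') in E.
- (* The union of a chain [C] of partial assignments. *)
  pose hC (x : X) : option U :=
    if pselect (exists u, exists t, C t /\ sval t x = Some u) is left e
    then Some (projT1 (cid e)) else None.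
  have hCP t x u : C t -> sval t x = Some u -> hC x = Some u.
    move=> Ct tx; rewrite /hC; case: pselect => [e|[]]; last by exists u, t.
    case: (cid e) => u' [t' [Ct' t'x]] /=; congr Some.
    have [/asboolP tt'|/asboolP tt'] := Ctot _ _ Ct Ct'.
      by move: (tt' _ _ tx); rewrite t'x => -[].
    by move: (tt' _ _ t'x); rewrite tx => -[].
  have hCE x u : hC x = Some u -> exists t, C t /\ sval t x = Some u.
    by rewrite /hC; case: pselect => // e [<-]; case: (cid e).
  have hCg : good hC.
    move=> s.
    have [l hl] := pdefinable_support (pdefinable_allseq
      (fun (i : {classic I}) (_ : i \in s) => dG i)).
    have [[t0 Ct0]|nC] := pselect (exists t, C t); last first.
      have [a Ha] := fs s; exists a; split=> // x u /hCE[t [Ct _]].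
      by case: nC; exists t.
    have [t [Ct ht]] : exists t, C t /\ forall x : {classic X}, x \in l ->
        forall u, hC x = Some u -> sval t x = Some u.
      elim: (l) => [|x l' [t [Ct ht]]]; first by exists t0.
      case E : (hC x) => [u|]; last first.
        exists t; split=> // y; rewrite inE => /orP[/eqP->|]; last exact: ht.
        by move=> u; rewrite E.
      have [t' [Ct' t'x]] := hCE _ _ E.
      have [/asboolP tt'|/asboolP tt'] := Ctot _ _ Ct Ct'.
        exists t'; split=> // y; rewrite inE => /orP[/eqP-> v|yl v yv].
          by rewrite E => -[<-].
        exact: tt' (ht _ yl _ yv).
      exists t; split=> // y; rewrite inE => /orP[/eqP-> v|]; last exact: ht.
      by rewrite E => -[<-]; exact: tt'.
    have [a [Ga ea]] := svalP t s.
    exists (fun x => if hC x is Some u then u else a x); split; last first.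
      by move=> x u ->.
    apply: hl Ga => x xl; case E : (hC x) => [u|//].
    by apply: ea; exact: ht.
  by exists (exist good hC hCg) => t Ct; apply/asboolP => x u; exact: hCP.
have {}hmax h' : good h' -> (forall x u, h x = Some u -> h' x = Some u) -> h' = h.
  move=> h'g H; have := hmax (exist good h' h'g).
  by move=> /(_ (asboolT H)) [].
have htot x : exists u, h x = Some u.
  case E : (h x) => [u|]; first by exists u.
  pose B := A `|` [set u | exists y, h y = Some u].
  have sB : small K B.
    apply: small_setU => //.
    have [u0] := carrier_inhabited U.
    apply: (@small_image _ X _ (fun y => odflt u0 (h y))) => //.
    by move=> u [y hy]; exists y; rewrite hy.
  (* The type of the value of [x]: one formula for each finite part of [G]. *)
  pose Rs (s : seq {classic I}) (u : 'I_1 -> U) :=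
    exists a, ext h a /\ a x = u ord0 /\ forall i : {classic I}, i \in s -> G i a.
  have dRs s : pdefinable B (Rs s).
    have Bh y u : h y = Some u -> B u by move=> hy; right; exists y.
    pose r (y : X) : (X + 'I_1) + {u | B u} :=
      match pselect (y = x) with
      | left _ => inl (inr ord0)
      | right _ => match h y as o return h y = o -> _ with
        | Some u => fun e => inr (exist B u (Bh y u e))
        | None => fun _ => inl (inl y) end erefl
      end.
    have dG' : pdefinable B (fun a => forall i : {classic I}, i \in s -> G i a).
      apply: (pdefinable_sub (A := A)); first by move=> ? ?; left.
      by apply: pdefinable_allseq => i _; exact: dG.
    apply: (pdefinable_ext (pdefinable_exV (pdefinable_bind r dG'))) => u.
    split=> [[a Ha]|[a [ea [ax Ha]]]].
      exists (tuple_join (tuple_join a u) sval \o r); split; last split=> //.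
        move=> y v hy; rewrite /= /r; case: pselect => [yx|_].
          by rewrite yx E in hy.
        by move: (erefl _); rewrite {2 3}hy.
      by rewrite /= /r; case: pselect.
    exists a; have -> // : tuple_join (tuple_join a u) sval \o r = a.
    apply: funext => y /=; rewrite /r; case: pselect => [->//|_].
    by move: (erefl _); case: {2 3}(h y) => //= v hv; rewrite (ea _ _ hv).
  have [S|a Ha] := saturated_pdefinable sB dRs.
    have [s' hs'] : exists s' : seq {classic I}, forall s, s \in S ->
        forall i : {classic I}, i \in (s : seq {classic I}) -> i \in s'.
      elim: (S) => [|s S' [s' IH]]; first by exists [::].
      exists ((s : seq {classic I}) ++ s') => t; rewrite inE => /orP[/eqP->|tS] i it.
        by rewrite mem_cat it.
      by rewrite mem_cat (IH t tS i it) orbT.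
    have [a [Ga ea]] := hgood s'.
    exists (fun=> a x) => s sS; exists a; split=> //; split=> // i si.
    by apply: Ga; exact: hs' si.
  pose h' y := if pselect (y = x) then Some (a ord0) else h y.
  have : h' = h.
    apply: hmax => [s|y u hy].
      have [b [eb [bx Gb]]] := Ha s; exists b; split=> // y u; rewrite /h'.
      by case: pselect => /= [yx [<-]|_]; [rewrite yx|exact: eb].
    by rewrite /h'; case: pselect => // yx; rewrite yx E in hy.
  move=> /(congr1 (fun f => f x)); rewrite E /h'; case: pselect => //.
have [f hf] := choice htot; exists f => i.
have [a [Ga ea]] := hgood [:: (i : {classic I})].
have <- : a = f by apply: funext => x; exact: ea.
by apply: Ga; rewrite mem_head.
Qed.

End Saturation.

(** * Small countably saturated elementary submodels *)

Section Submodels.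
Context (L : language) (U : structure L).

Definition tarski_vaught (N : set U) : Prop :=
  N !=set0 /\ forall P : (unit -> U) -> Prop, pdefinable N P ->
    (exists u, P u) -> exists u, N (u tt) /\ P u.

Lemma tarski_vaught_elementary (N : set U) :
  tarski_vaught N -> elementary_subset N.
Proof.
move=> [[x0 Nx0] tv].
have fN (f : fsym L) (v : 'I_(far f) -> {x | N x}) : N (fint (sval \o v)).
  have [||u [Nu <-//]] := tv (fun u => u tt = fint (sval \o v)).
    exists (fun w => w (inl tt) = fint (fun i => w (inr (v i)))); split=> //.
    exists (FEq (@Var L (unit + {x | N x}) (inl tt)) (App (fun i => Var L (inr (v i))))).
    by [].
  by exists (fun=> fint (sval \o v)).
pose S : structure L := @Structure L {x | N x} (fun f v => exist _ _ (fN f v))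
  (fun r v => rint (sval \o v)) (inhabits (exist _ x0 Nx0)).
pose e : S -> U := sval.
exists S, e; split; last first.
  apply/seteqP; split=> [_ [[x Nx] _ <-]//|x Nx].
  by exists (exist _ x Nx).
have te (V : Type) (t : term L V) (v : V -> S) : e (teval t v) = teval t (e \o v).
  elim: t => //= f ts IH; congr fint; apply: funext => i; exact: IH.
suff H (V : Type) (phi : formula L V) (v : V -> S) : eval phi v <-> eval phi (e \o v).
  by move=> n phi v.
elim: phi v => {V} [V s t|V r ts|V|V a IHa b IHb|V a IHa] v //=.
- by rewrite -!te; split=> [->//|E]; apply: eq_sig_hprop => // ? ? ?; exact: Prop_irrelevance.
- have -> // : (fun i => teval (ts i) (e \o v)) = sval \o (fun i => teval (ts i) v).
  by apply: funext => i; rewrite -te.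
- by rewrite IHa IHb.
have E (u : S) : ocons (e u) (e \o v) = e \o ocons u v by apply: funext => -[].
split=> [H u|H u]; last first.
  by apply/IHa; have := H (e u); rewrite -/(ocons _ _) E.
apply: contrapT => nH.
pose P (w : unit -> U) := ~ eval a (ocons (w tt) (e \o v)).
have dP : pdefinable N P.
  pose r (x : option V) : unit + {x | N x} := if x is Some y then inr (v y) else inl tt.
  exists (fun w => ~ eval a (w \o r)); split.
    exact: (definable_not (definable_rename r (definable_eval U a))).
  move=> w; have -> // : tuple_join w sval \o r = ocons (w tt) (e \o v).
  by apply: funext => -[].
have [w [Nw]] := tv P dP (ex_intro _ (fun=> u) nH); apply.
have := H (exist _ (w tt) Nw); rewrite IHa.
by rewrite -[X in eval a X]/(e \o ocons (exist _ (w tt) Nw : S) v) -E.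
Qed.

Definition countably_saturated (M : set U) : Prop :=
  M !=set0 /\ forall (A B : countType) (c : A -> U) (e : B -> U),
    (forall a, M (c a)) -> exists z : B -> U, (forall b, M (z b)) /\
      forall P : (B + A -> U) -> Prop, definable P ->
        P (tuple_join e c) -> P (tuple_join z c).

Lemma countably_saturated_tv (M : set U) :
  countably_saturated M -> tarski_vaught M.
Proof.
move=> [M0 sat_M]; split=> // P /pdefinable_sat[psi [Mpsi hpsi]] [u Pu].
have [z [Mz hz]] := sat_M 'I__ unit (@par _ _ _ psi) u Mpsi.
exists z; split=> //; apply/hpsi; apply: hz; first exact: definable_eval.
exact/hpsi.
Qed.

Variable K : Type.
Hypotheses (K_lim : strong_limit K) (sf : small K [set: fsym L])
  (sr : small K [set: rsym L]).

(** The submodel consists of the values of well-founded trees: a node applies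
to the values of its countably many children a function choosing a realization
of a given countable type. *)
Lemma countably_saturated_exists (M0 : set U) : small K M0 ->
  exists M, [/\ small K M, M0 `<=` M & countably_saturated M].
Proof.
move=> /small_sig sM0; have [u0] := carrier_inhabited U.
pose real (s : set (formula L (nat + nat))) (c z : nat -> U) :=
  forall phi, s phi -> eval phi (tuple_join z c).
pose F s c : nat -> U :=
  if pselect (exists z, real s c z) is left e then projT1 (cid e) else fun=> u0.
have FP s c z : real s c z -> real s c (F s c).
  by move=> H; rewrite /F; case: pselect => [e|[]]; [case: (cid e)|exists z].
pose lab : Type := {x | M0 x} + set (formula L (nat + nat)) * nat.
pose val := fix val (t : tree lab) : U := match t with
  | Leaf a => if a is inl x then sval x else u0
  | Node a ch => match a with inl x => sval x | inr (s, j) => F s (val \o ch) j end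
  end.
exists (range val); split.
- apply: small_range; apply: smallT_tree => //; apply: smallT_sum => //.
  apply: smallT_prod => //; last exact: smallT_nat.
  by apply: smallT_set => //; exact: smallT_formula.
- by move=> x M0x; exists (Leaf (inl (exist _ x M0x))).
split; first by exists u0, (Leaf (inr (set0, 0))).
have sat1 (c e : nat -> U) : (forall i, range val (c i)) ->
    exists z : nat -> U, (forall i, range val (z i)) /\
      forall phi : formula L (nat + nat),
        eval phi (tuple_join e c) -> eval phi (tuple_join z c).
  move=> Mc.
  have Mc' i : exists t, val t = c i by have [t _] := Mc i; exists t.
  have [ch hch] := choice Mc'.
  pose s := [set phi : formula L (nat + nat) | eval phi (tuple_join e c)].
  exists (F s c); split=> [j|phi H]; last exact: (FP s c e _ phi).
  exists (Node (inr (s, j)) ch) => //=; congr (F s _ j).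
  by apply: funext => i; exact: hch.
move=> A B c e Mc.
pose c' i := if unpickle i is Some a then c a else u0.
pose e' i := if unpickle i is Some b then e b else u0.
have [|z [Mz hz]] := sat1 c' e'.
  move=> i; rewrite /c'; case: (unpickle i) => //.
  by exists (Leaf (inr (set0, 0))).
exists (z \o pickle); split=> [b|P dP]; first exact: Mz.
pose r (x : B + A) : nat + nat :=
  match x with inl b => inl (pickle b) | inr a => inr (pickle a) end.
have E : tuple_join e c = tuple_join e' c' \o r.
  by apply: funext => -[x|x] /=; rewrite /e' /c' pickleK.
have E' : tuple_join (z \o pickle) c = tuple_join z c' \o r.
  by apply: funext => -[x|x] //=; rewrite /c' pickleK.
rewrite E E'; have [phi h] := definable_rename r dP.
by rewrite -!h; exact: hz.
Qed.

End Submodels.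

(** * Iterated ultrafilter quantifiers *)

Record nonprincipal (F : set (set nat)) : Prop := Nonprincipal {
  ult_sub : forall P Q : set nat, P `<=` Q -> F P -> F Q;
  ult_and : forall P Q : set nat, F P -> F Q -> F (P `&` Q);
  ult_not : forall P : set nat, F (~` P) <-> ~ F P;
  ult_large : forall n, F [set i | (n < i)%N] }.

Lemma nonprincipal_exists : exists F, nonprincipal F.
Proof.
have [F [FU sF]] := @ultraFilterLemma nat \oo _.
exists F; split=> [P Q|P Q|P|n].
- exact: filterS.
- exact: filterI.
- split=> [FnP FP|nFP].
    by have [x []] := filter_ex (filterI FP FnP).
  by have [//|] := in_ultra_setVsetC P FU.
- by apply: sF; exists n.+1.
Qed.

Definition upd (w : nat -> nat) (L i : nat) : nat -> nat :=
  fun n => if n == L then i else w n.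

Definition depends (l : nat) (P : (nat -> nat) -> Prop) : Prop :=
  forall w w', (forall i, (i < l)%N -> w i = w' i) -> P w -> P w'.

Lemma depends_iff (l : nat) (P : (nat -> nat) -> Prop) (w w' : nat -> nat) :
  depends l P -> (forall i, (i < l)%N -> w i = w' i) -> P w <-> P w'.
Proof. by move=> dP ww'; split; apply: dP => // i il; rewrite ww'. Qed.

Definition increasing_on (l : nat) (s : nat -> nat) : Prop :=
  forall i j, (i < j < l)%N -> (s i < s j)%N.

Section Most.
Context (F : set (set nat)) (F_ult : nonprincipal F).

Lemma ult_ext (P Q : set nat) : (forall i, P i <-> Q i) -> F P <-> F Q.
Proof. by move=> PQ; split; apply: ult_sub => // i /PQ. Qed.

Lemma ult_const (P : Prop) : F [set _ | P] <-> P.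
Proof.
have FT : F setT by apply: ult_sub (ult_large F_ult 0).
have [p|np] := pselect P; split=> //.
  by move=> _; apply: ult_sub FT.
move=> FP; have /(ult_not F_ult)[] : F (~` [set _ | P]) by apply: ult_sub FT.
exact: FP.
Qed.

Lemma ult_ex (P : set nat) : F P -> exists i, P i.
Proof.
move=> FP; apply: contrapT => nP; apply/(ult_const False).
by apply: ult_sub FP => // i Pi; apply: nP; exists i.
Qed.

(** [most L P] says that for [F]-most [w 0], for [F]-most [w 1], ..., for
[F]-most [w L.-1], the sequence [w] satisfies [P]: it is membership in a product
ultrafilter. The recursion exposes the innermost quantifier. *)
Fixpoint most (L : nat) (P : (nat -> nat) -> Prop) : Prop :=
  match L with
  | 0 => P (fun=> 0)
  | L'.+1 => most L' (fun w => F [set i | P (upd w L' i)])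
  end.

Lemma most_sub (L : nat) (P Q : (nat -> nat) -> Prop) :
  (forall w, P w -> Q w) -> most L P -> most L Q.
Proof.
elim: L P Q => [|L IH] P Q PQ /=; first exact: PQ.
by apply: IH => w; apply: ult_sub => // i; exact: PQ.
Qed.

Lemma most_ext (L : nat) (P Q : (nat -> nat) -> Prop) :
  (forall w, P w <-> Q w) -> most L P <-> most L Q.
Proof. by move=> PQ; split; apply: most_sub => w /PQ. Qed.

Lemma most_and (L : nat) (P Q : (nat -> nat) -> Prop) :
  most L P -> most L Q -> most L (fun w => P w /\ Q w).
Proof.
elim: L P Q => [|L IH] P Q //= mP mQ.
by apply: most_sub (IH _ _ mP mQ) => w [FP FQ]; exact: ult_and.
Qed.

Lemma most_not (L : nat) (P : (nat -> nat) -> Prop) :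
  most L (fun w => ~ P w) <-> ~ most L P.
Proof.
elim: L P => [|L IH] P //=; rewrite -IH; apply: most_ext => w.
exact: (ult_not F_ult [set i | P (upd w L i)]).
Qed.

Lemma most_const (L : nat) (P : Prop) : most L (fun=> P) <-> P.
Proof.
elim: L => //= L IH; rewrite -[X in _ <-> X]IH; apply: most_ext => w.
exact: ult_const.
Qed.

Lemma most_all (L : nat) (P : (nat -> nat) -> Prop) :
  (forall w, P w) -> most L P.
Proof. by move=> H; apply: most_sub ((most_const L True).2 Logic.I) => w _. Qed.

Lemma most_ex (L : nat) (P : (nat -> nat) -> Prop) : most L P -> exists w, P w.
Proof.
move=> mP; apply: contrapT => nP; apply/(most_const L False).
by apply: most_sub mP => w Pw; apply: nP; exists w.
Qed.

Lemma most_allseq (I : eqType) (s : seq I) (L : nat) (P : I -> (nat -> nat) -> Prop) :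
  (forall i, i \in s -> most L (P i)) ->
  most L (fun w => forall i, i \in s -> P i w).
Proof.
elim: s => [|i s IH] H; first by apply: most_all.
apply: most_sub (most_and (H i (mem_head _ _)) (IH _)) => [w [Pi Ps] j|j js].
  by rewrite inE => /orP[/eqP->//|]; exact: Ps.
by apply: H; rewrite inE js orbT.
Qed.

(** Quantifiers over coordinates on which [P] does not depend can be removed, so
the limit along a subsequence of coordinates only depends on its length. *)
Lemma most_restrict (L l : nat) (g : nat -> nat) (P : (nat -> nat) -> Prop) :
  depends l P -> increasing_on l g -> (forall i, (i < l)%N -> (g i < L)%N) ->
  most L (fun w => P (w \o g)) <-> most l P.
Proof.
elim: L l g P => [|L IH] [|l] g P dP ginc gL //=; try by have := gL 0 isT.
  rewrite -(most_const L (P (fun=> 0))); apply: most_ext => w.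
  by rewrite -(ult_const (P (fun=> 0))); apply: ult_ext => i; exact: (depends_iff dP).
have [gl|gl] := eqVneq (g l) L.
  rewrite -(IH l g (fun w => F [set i | P (upd w l i)])).
  - apply: most_ext => w; apply: ult_ext => i; apply: (depends_iff dP) => j.
    rewrite ltnS leq_eqVlt => /orP[/eqP->|jl].
      by rewrite /upd /= gl !eqxx.
    have gj : (g j < L)%N by rewrite -gl; apply: ginc; rewrite jl /=.
    by rewrite /upd /= (ltn_eqF gj) (ltn_eqF jl).
  - move=> w w' ww'; apply: ult_sub => // i; apply: dP => j jl.
    rewrite /upd; case: eqVneq => // jl'; apply: ww'.
    by rewrite ltn_neqAle jl' -ltnS.
  - by move=> i j /andP[ij jl]; apply: ginc; rewrite ij ltnW.
  - by move=> i il; rewrite -gl; apply: ginc; rewrite il /=.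
have gL' i : (i < l.+1)%N -> (g i < L)%N.
  have lL : (g l < L)%N by rewrite ltn_neqAle gl -ltnS; exact: gL.
  rewrite ltnS leq_eqVlt => /orP[/eqP->//|il].
  by apply: ltn_trans lL; apply: ginc; rewrite il /=.
rewrite -[X in _ <-> X]/(most l.+1 P) -(IH l.+1 g P)//.
apply: most_ext => w; rewrite -[X in _ <-> X]ult_const; apply: ult_ext => i.
apply: (depends_iff dP) => j jl; rewrite /upd /=.
by rewrite (ltn_eqF (gL' _ jl)).
Qed.

Lemma most_increasing (L : nat) :
  most L (increasing_on L).
Proof.
elim: L => [|L IH] /=; first by move=> i j; rewrite ltn0 andbF.
apply: most_sub IH => w winc.
apply: ult_sub (ult_large F_ult (\max_(j < L) w j)) => // n /= ln i j.
rewrite /upd ltnS => /andP[ij]; rewrite leq_eqVlt => /orP[/eqP jL|jL].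
  rewrite jL eqxx; move: ij; rewrite jL => iL; rewrite (ltn_eqF iL).
  exact: leq_ltn_trans (leq_bigmax (Ordinal iL)) ln.
by rewrite (ltn_eqF jL) (ltn_eqF (ltn_trans ij jL)); apply: winc; rewrite ij.
Qed.

End Most.

(** * Sauer-Shelah and its consequences for dependent relations *)

Lemma seq_bound (I : eqType) (s : seq I) (f : I -> nat) :
  exists d, forall z, z \in s -> (f z < d)%N.
Proof.
elim: s => [|z s [d hd]]; first by exists 0.
exists (maxn d (f z).+1) => y; rewrite inE => /orP[/eqP->|/hd yd].
  by rewrite leq_max leqnn orbT.
by rewrite leq_max yd.
Qed.

Section Pajor.
Import mathcomp.boot.finset.
Local Open Scope set_scope.
Context (T : finType).
Implicit Types (F : {set {set T}}) (S A B : {set T}).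

Definition shattered_by F S : bool :=
  [forall A : {set T}, (A \subset S) ==> [exists B in F, B :&: S == A]].

Definition shattered F : {set {set T}} := [set S | shattered_by F S].

Lemma shatteredP F S : reflect
  (forall A, A \subset S -> exists2 B, B \in F & B :&: S = A) (S \in shattered F).
Proof.
rewrite inE; apply: (iffP forallP) => H A.
  by move=> AS; have /implyP/(_ AS)/existsP[B /andP[BF /eqP]] := H A; exists B.
apply/implyP => /H[B BF BS]; apply/existsP; exists B.
by rewrite BF BS eqxx.
Qed.

(** Pajor's form of the Sauer-Shelah lemma. Let two members of [F] differ at
[x], and split [F] according to membership of [x]. A set shattered by both
halves is counted twice by the induction hypothesis, but it avoids [x] and adding
[x] to it gives a second set shattered by [F]. *)
Lemma pajor F : (#|F| <= #|shattered F|)%N.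
Proof.
have [n] := ubnP #|F|; elim: n => // n IH in F * => Fn.
have [F1|F1] := leqP #|F| 1.
  have [->|[B BF]] := set_0Vmem F; first by rewrite cards0.
  apply: leq_trans F1 _; rewrite card_gt0; apply/set0Pn; exists set0.
  apply/shatteredP => A; rewrite subset0 => /eqP->.
  by exists B; rewrite // setI0.
have [B0 [B1 [F0 F1' B01]]] : exists B0 B1, [/\ B0 \in F, B1 \in F & B0 != B1].
  have /card_gt0P[B0 F0] : (0 < #|F|)%N by exact: ltnW.
  have : (0 < #|F :\ B0|)%N by move: F1; rewrite (cardsD1 B0) F0.
  move=> /card_gt0P[B1]; rewrite !inE => /andP[n01 F1'].
  by exists B0, B1; rewrite eq_sym.
have [x hx] : exists x, (x \in B0) != (x \in B1).
  apply/existsP; apply: contraR B01; rewrite negb_exists => /forallP H.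
  by apply/eqP/setP => x; apply/eqP; have := H x; rewrite negbK.
pose Fb (b : bool) := [set B in F | (x \in B) == b].
have Fb0 b : (0 < #|Fb b|)%N.
  apply/card_gt0P; have [E|E] := eqVneq (x \in B0) b.
    by exists B0; rewrite inE F0 E eqxx.
  exists B1; rewrite inE F1' /=; apply/eqP; move: hx E.
  by case: (x \in B0); case: (x \in B1); case: b.
have sumF : (#|F| = #|Fb true| + #|Fb false|)%N.
  rewrite -(cardsID [set B : {set T} | x \in B] F); congr (_ + _)%N.
    by apply: eq_card => B; rewrite !inE eqb_id.
  by apply: eq_card => B; rewrite !inE eqbF_neg andbC.
have Fbn b : (#|Fb b| < n)%N.
  by move: (Fb0 (~~ b)) Fn; rewrite sumF; case: b => /=; lia.
have xS b S : S \in shattered (Fb b) -> x \notin S.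
  move=> /shatteredP H; apply/negP => xS.
  have cS : (if b then set0 else [set x]) \subset S.
    by case: b {H}; rewrite ?sub0set ?sub1set.
  have [B] := H _ cS.
  rewrite inE => /andP[_ /eqP xB] /setP/(_ x).
  by rewrite !inE xS andbT xB; case: b {H xB cS}; rewrite !inE ?eqxx.
pose S0 := shattered (Fb false); pose S1 := shattered (Fb true).
pose S2 := [set x |: S | S in S0 :&: S1].
have cS2 : #|S2| = #|S0 :&: S1|.
  apply: card_in_imset => S S'; rewrite !inE => /andP[h _] /andP[h' _] E.
  have nS : x \notin S by apply: (xS false); rewrite inE.
  have nS' : x \notin S' by apply: (xS false); rewrite inE.
  by rewrite -(setU1K nS) E setU1K.
have dS2 : (S0 :|: S1) :&: S2 = set0.
  apply/setP => S; rewrite in_set0 in_setI; apply/negP => /andP[SS /imsetP[S' _ E]].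
  have : x \notin S by move: SS; rewrite in_setU => /orP[/xS|/xS].
  by rewrite E !inE eqxx.
have sub : (S0 :|: S1) :|: S2 \subset shattered F.
  have sb b S : S \in shattered (Fb b) -> S \in shattered F.
    move=> /shatteredP H; apply/shatteredP => A /H[B].
    by rewrite inE => /andP[BF _]; exists B.
  apply/fintype.subsetP => S; rewrite !in_setU => /orP[/orP[/sb|/sb]//|].
  move=> /imsetP[S']; rewrite inE => /andP[/[dup] S'0 /shatteredP h0 /shatteredP h1] ->.
  apply/shatteredP => A AS.
  have [|B] := (if x \in A as b return (forall A', A' \subset S' ->
      exists2 B, B \in Fb b & B :&: S' = A') then h1 else h0) (A :\ x).
    by rewrite subDset.
  rewrite inE => /andP[BF /eqP xB] E; exists B => //.
  apply/setP => y; move/setP/(_ y): E; rewrite !inE.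
  have [->|yx] := eqVneq y x; first by rewrite xB andbT.
  by [].
apply: leq_trans (subset_leq_card sub).
rewrite cardsU dS2 cards0 subn0 cS2 cardsU subnK; last first.
  exact: leq_trans (subset_leq_card (subsetIl _ _)) (leq_addr _ _).
by rewrite sumF addnC; apply: leq_add; apply: IH; exact: Fbn.
Qed.

Lemma card_small_sets (d : nat) (F : {set {set T}}) :
  (forall S, S \in F -> (#|S| <= d)%N) -> (#|F| <= (#|T|.+1) ^ d)%N.
Proof.
move=> Fd; pose g (f : {ffun 'I_d -> option T}) := [set x | Some x \in codom f].
have sub : F \subset [set g f | f in setT].
  apply/fintype.subsetP => S /Fd Sd; apply/imsetP.
  exists [ffun i : 'I_d => nth None [seq Some x | x <- enum S] i] => //.
  apply/setP => x; rewrite inE; apply/idP/codomP => [xS|[i]].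
    have iS : (index x (enum S) < #|S|)%N by rewrite cardE index_mem mem_enum.
    exists (Ordinal (leq_trans iS Sd)); rewrite ffunE /= (nth_map x) -?cardE//.
    by rewrite nth_index// mem_enum.
  rewrite ffunE; have [iS|iS] := ltnP i #|S|.
    rewrite (nth_map x) -?cardE// => -[->].
    by rewrite -mem_enum mem_nth// -cardE.
  by rewrite nth_default// size_map -cardE.
apply: leq_trans (subset_leq_card sub) _; apply: leq_trans (leq_imset_card _ _) _.
by rewrite cardsT card_ffun card_option card_ord.
Qed.

End Pajor.

Section Shattering.
Import mathcomp.boot.finset.
Local Open Scope set_scope.
Context (A B : Type).

Definition shatters (R : A -> B -> Prop) (d : nat) : Prop :=
  exists a : 'I_d -> A, forall S : {set 'I_d}, exists b, forall i, R (a i) b <-> i \in S.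

Definition traces (R : A -> B -> Prop) (T : finType) (a : T -> A) : {set {set T}} :=
  [set S : {set T} | `[< exists b, forall t, R (a t) b <-> t \in S >]].

(** By [pajor], there are at most as many traces as shattered sets of points, and
these have at most [d] elements. *)
Lemma card_traces (R : A -> B -> Prop) (d : nat) : ~ shatters R d.+1 ->
  forall (T : finType) (a : T -> A), (#|traces R a| <= (#|T|.+1) ^ d)%N.
Proof.
move=> nR T a; apply: leq_trans (pajor _) _; apply: card_small_sets => S.
move=> /shatteredP H; rewrite leqNgt; apply/negP => dS; apply: nR.
pose e (i : 'I_d.+1) := enum_val (widen_ord dS i).
have einj : injective e.
  by move=> i j /enum_val_inj /(congr1 val) /= E; exact: val_inj.
exists (a \o e) => D; have [|C] := H [set e i | i in D].
  by apply/fintype.subsetP => x /imsetP[i _ ->]; exact: enum_valP.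
rewrite inE => /asboolP[b hb] E; exists b => i /=; rewrite hb.
move/setP/(_ (e i)): E; rewrite inE [_ \in S]enum_valP andbT => ->.
by rewrite mem_imset.
Qed.

(** The parameters that realize all the subsets of a shattered set are
themselves shattered by the points of this set. *)
Lemma dual_shatters (R : A -> B -> Prop) (d : nat) : ~ shatters R d ->
  exists d', ~ (exists b : 'I_d' -> B, forall S : {set 'I_d'},
    exists a, forall i, R a (b i) <-> i \in S).
Proof.
move=> nR; exists #|{: {set 'I_d}}| => -[b hb]; apply: nR.
have ha i : exists a, forall S, R a (b (enum_rank S)) <-> i \in S.
  have [a h] := hb [set enum_rank S | S in [set S : {set 'I_d} | i \in S]].
  exists a => S; rewrite h mem_imset ?inE//; exact: enum_rank_inj.
have [a h] := choice ha; exists a => S; exists (b (enum_rank S)) => i; exact: h.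
Qed.

End Shattering.

Lemma exp2_dominates (c D : nat) : exists N, ((c * N + 1) ^ D < 2 ^ N)%N.
Proof.
pose s := (c + D + 4)%N.
have h3 : (3 * s <= 2 ^ s)%N.
  rewrite /s; elim: (c + D)%N => // n IH; rewrite addSn expnS; move: IH.
  rewrite -[(n + 4).+1]addn1; have := ltn_expl (n + 4) (isT : (1 < 2)%N); lia.
exists (2 ^ (2 * s))%N.
have hc : (c * 2 ^ (2 * s) + 1 <= 2 ^ (c + 2 * s))%N.
  rewrite expnD; have := ltn_expl c (isT : (1 < 2)%N).
  have := expn_gt0 2 (2 * s); nia.
apply: (@leq_ltn_trans ((2 ^ (c + 2 * s)) ^ D)%N).
  by case: (D) => [|D']; rewrite ?expn0// leq_exp2r.
rewrite -expnM ltn_exp2l// mulnC [(2 * s)%N]mulSn mul1n expnD.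
have : (D < 2 ^ s)%N by apply: leq_ltn_trans (ltn_expl s (isT : (1 < 2)%N)); rewrite /s; lia.
have : (c + (s + s) <= 2 ^ s)%N by apply: leq_trans h3; rewrite /s; lia.
have := expn_gt0 2 s.
nia.
Qed.

(** In an array with [2 k] columns and [N] rows, the point realizing a path has
a trace that contains the path and meets each row in fewer than [k] entries. A
trace then serves at most [k ^ N] of the [(2 k) ^ N] paths, so there are at least
[2 ^ N] traces on [2 k N] points, against the Sauer-Shelah bound. *)
Lemma tree_property_shatters (A B : Type) (R : A -> B -> Prop) (k : nat) :
  (forall N, exists e : nat -> nat -> B,
     (forall s, (s < N)%N -> forall i : 'I_k -> nat, injective i ->
        ~ exists x, forall j, R x (e s (i j))) /\
     (forall f : nat -> nat, exists x, forall s, (s < N)%N -> R x (e s (f s)))) ->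
  forall d, exists b : 'I_d -> B, forall S : {set 'I_d},
    exists a, forall i, R a (b i) <-> i \in S.
Proof.
move=> arr [|d].
  have [e [_ /(_ id)[x _]]] := arr 0.
  by exists (fun i => e i i) => S; exists x => -[].
apply: contrapT => nR.
have k_gt0 : (0 < k)%N.
  rewrite lt0n; apply/eqP => k0; have [e [inc /(_ id)[x _]]] := arr 1.
  have E (i : 'I_k) : False by rewrite k0 in i; case: i.
  by apply: (inc 0 isT (fun i => 0)) => [i|]; [case: (E i)|exists x => i; case: (E i)].
have [N hN] := exp2_dominates (2 * k) d.
have [e [inc path]] := arr N.
pose J := (2 * k)%N.
pose T : finType := ('I_N * 'I_J)%type.
pose pt (t : T) : B := e t.1 t.2.
pose Fam := traces (fun y x => R x y) pt.
have cF : (#|Fam| <= (#|T|.+1) ^ d)%N by exact: (card_traces nR).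
have tr (f : {ffun 'I_N -> 'I_J}) :
    exists S : {set T}, S \in Fam /\ forall s, (s, f s) \in S.
  have [x hx] := path (fun s => if insub s is Some s' then val (f s') else 0).
  exists [set t : T | `[< R x (pt t) >]]%SET; split.
    by rewrite inE; apply/asboolP; exists x => t; rewrite inE; split=> [/asboolP|/asboolP].
  by move=> s; rewrite inE; apply/asboolP; have := hx s (ltn_ord s); rewrite valK.
have [g hg] := choice tr.
have fib (S : {set T}) : S \in Fam -> (#|[pred f | g f == S]| <= k ^ N)%N.
  rewrite inE => /asboolP[x hx].
  have sub : {subset [pred f | g f == S] <=
      family (fun s : 'I_N => [pred j : 'I_J | (s, j) \in S])}.
    move=> f; rewrite inE => /eqP gf; apply/familyP => s.
    by rewrite inE -gf; exact: (hg f).2.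
  apply: leq_trans (subset_leq_card (introT fintype.subsetP sub)) _.
  rewrite card_family.
  have row s : (#|[pred j : 'I_J | (s, j) \in S]| <= k)%N.
    rewrite leqNgt; apply/negP => kS.
    pose i (j : 'I_k) := val (enum_val (widen_ord (ltnW kS) j)).
    apply: (inc s (ltn_ord s) i) => [j j' /val_inj /enum_val_inj /(congr1 val) E|].
      exact: val_inj.
    exists x => j; have := enum_valP (widen_ord (ltnW kS) j).
    by rewrite inE => /hx.
  rewrite foldrE big_map big_enum /=.
  apply: (@leq_trans (\prod_(s : 'I_N) k)%N).
    by apply: leq_prod => s _; exact: row.
  by rewrite prod_nat_const card_ord.
have : (J ^ N <= #|Fam| * k ^ N)%N.
  have -> : (J ^ N = \sum_(f : {ffun 'I_N -> 'I_J}) 1)%N.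
    by rewrite sum1_card card_ffun !card_ord.
  rewrite (partition_big g (mem Fam)) /=; last by move=> f _; exact: (hg f).1.
  rewrite -sum_nat_const; apply: leq_sum => S SF; rewrite sum1_card; exact: fib.
rewrite /J expnMn leq_pmul2r ?expn_gt0 ?k_gt0//.
move=> /leq_trans/(_ cF); rewrite card_prod !card_ord -[(_ * _).+1]addn1 /J [(N * _)%N]mulnC.
by rewrite leqNgt hN.
Qed.

Section NIPFinite.
Context (L : language) (K : Type) (U : structure L).
Hypotheses (K_lim : strong_limit K) (U_sat : saturated K U).

Definition formula_rel (n m : nat) (phi : formula L ('I_n + 'I_m)) (a : 'I_n -> U)
    (b : 'I_m -> U) : Prop := eval phi (tuple_join a b).

(** By compactness, arbitrarily large finite shattered sets give an infinite
one. *)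
Lemma NIP_shatters (n m : nat) (phi : formula L ('I_n + 'I_m)) :
  NIP U phi -> exists d, ~ shatters (formula_rel phi) d.
Proof.
move=> nip; apply: contrapT => /forallNP H; apply: nip.
have {}H d : shatters (formula_rel phi) d by exact: contrapT (H d).
have [u0] := carrier_inhabited U.
pose X : Type := nat * 'I_n + set nat * 'I_m.
pose G (z : nat * set nat) (v : X -> U) : Prop :=
  formula_rel phi (fun j => v (inl (z.1, j))) (fun j => v (inr (z.2, j))) <-> z.2 z.1.
have [|||s|v hv] := compactness K_lim U_sat (X := X) (A := set0) (G := G).
- have tn := smallT_nat K_lim.
  by apply: smallT_sum => //; apply: smallT_prod => //; try exact: smallT_count;
    exact: smallT_set.
- apply: (small_image (smallT_nat K_lim) (f := fun=> u0)) => y [].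
- move=> [i S]; apply: definable_pdefinable; apply: definable_iff.
    pose r (x : 'I_n + 'I_m) : X := match x with inl j => inl (i, j) | inr j => inr (S, j) end.
    apply: (definable_ext (definable_rename r (definable_eval U phi))) => v.
    rewrite /formula_rel.
    have -> // : v \o r = tuple_join (fun j => v (inl (i, j))) (fun j => v (inr (S, j))).
    by apply: funext => -[].
  exact: definable_const.
- have [d hd] := seq_bound s (fun z : nat * set nat => z.1).
  have [a ha] := H d; have [b hb] := choice ha.
  pose v (x : X) : U := match x with
    | inl (i, j) => if insub i is Some i' then a i' j else u0
    | inr (Z, j) => b [set i : 'I_d | `[< Z i >]]%SET j end.
  exists v => -[i S] zs; have id := hd _ zs.
  rewrite /G /= insubT; split=> [/hb|Si].
    by rewrite inE => /asboolP.
  by apply/hb; rewrite inE; apply/asboolP.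
exists (fun i j => v (inl (i, j))), (fun S j => v (inr (S, j))) => i S.
exact: (hv (i, S)).
Qed.

Lemma shatters_NIP (n m : nat) (phi : formula L ('I_n + 'I_m)) (d : nat) :
  ~ shatters (formula_rel phi) d -> NIP U phi.
Proof.
move=> nsh [a [b hab]]; apply: nsh; exists (fun i => a i) => S.
exists (b [set i | exists h : (i < d)%N, Ordinal h \in S]) => i.
rewrite /formula_rel hab /=; split=> [[h]|iS]; last first.
  by exists (ltn_ord i); rewrite (_ : Ordinal _ = i)//; exact: val_inj.
by rewrite (_ : Ordinal _ = i)//; exact: val_inj.
Qed.

Lemma NIP_dual (n m : nat) (phi : formula L ('I_n + 'I_m)) :
  NIP U phi -> exists d, ~ exists b : 'I_d -> 'I_m -> U, forall S : {set 'I_d},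
    exists a, forall i, formula_rel phi a (b i) <-> i \in S.
Proof. by move=> /NIP_shatters[d] /dual_shatters. Qed.

(** A trace of the union is determined by the traces of its members, so the
number of traces is still bounded by a polynomial. *)
Lemma NIP_union (n m k : nat) (phi : formula L ('I_n + 'I_m)) (l : 'I_k -> nat)
    (psi : forall al, formula L ('I_n + 'I_(l al)))
    (pr : forall al, ('I_m -> U) -> 'I_(l al) -> U) :
  (forall a b, formula_rel phi a b <-> exists al, formula_rel (psi al) a (pr al b)) ->
  (forall al, NIP U (psi al)) -> NIP U phi.
Proof.
move=> hphi nip.
have H al : exists d, ~ shatters (formula_rel (psi al)) d.+1.
  have [[|d] hd] := NIP_shatters (nip al); last by exists d.
  exists 0 => -[a ha]; apply: hd; exists (fun i => a ord0) => S.
  by have [b _] := ha (finset.set0); exists b => -[].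
have [d hd] := choice H.
have [N hN] := exp2_dominates 1 (\sum_al d al)%N.
apply: (@shatters_NIP _ _ _ N) => -[a ha].
have [b hb] := choice ha.
pose tr al (S : {set 'I_N}) : {set 'I_N} :=
  [set i | `[< formula_rel (psi al) (a i) (pr al (b S)) >]]%SET.
have trF al S : tr al S \in traces (formula_rel (psi al)) a.
  rewrite inE; apply/asboolP; exists (pr al (b S)) => i; rewrite inE.
  by split=> [/asboolP|/asboolP].
pose g (S : {set 'I_N}) : {ffun 'I_k -> {set 'I_N}} := [ffun al => tr al S].
have ginj : injective g.
  move=> S S' E; apply/finset.setP => i.
  have tE al : tr al S = tr al S' by have := congr1 (fun f : {ffun _} => f al) E; rewrite !ffunE.
  have memE (Z : {set 'I_N}) : i \in Z <-> exists al, i \in tr al Z.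
    rewrite -hb hphi; split=> -[al h]; exists al; move: h; rewrite inE.
      by move=> h; apply/asboolP.
    by move=> /asboolP.
  by apply/idP/idP => /memE[al h]; apply/memE; exists al; move: h; rewrite tE.
have : (2 ^ N <= N.+1 ^ (\sum_al d al))%N.
  have -> : (2 ^ N = #|powerset [set: 'I_N]%SET|)%N.
    by rewrite finset.card_powerset finset.cardsT card_ord.
  rewrite finset.powersetT finset.cardsT -(card_codom ginj).
  apply: (@leq_trans #|family (fun al => mem (traces (formula_rel (psi al)) a))|).
    apply/subset_leq_card/fintype.subsetP => f /codomP[S ->].
    by apply/familyP => al; rewrite ffunE; exact: trF.
  rewrite card_family foldrE big_map big_enum /= expn_sum.
  by apply: leq_prod => al _; have := card_traces (hd al) a; rewrite card_ord.
by move: hN; rewrite mul1n addn1 ltnNge => /negP.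
Qed.

End NIPFinite.

(** * Ultrapowers inside the monster *)

Section Common.
Context (L : language) (U : structure L) (n m : nat).
Context (phi : formula L ('I_n + 'I_m)).

Lemma definable_allnat (V : Type) (l : nat) (P : nat -> (V -> U) -> Prop) :
  (forall i, (i < l)%N -> definable (P i)) ->
  definable (fun v => forall i, (i < l)%N -> P i v).
Proof.
move=> dP; apply: (definable_ext (@definable_allseq _ _ V nat (iota 0 l) P _)).
  by move=> i; rewrite mem_iota; exact: dP.
by move=> v; split=> H i il; apply: H; rewrite ?mem_iota// in il *.
Qed.

Lemma pdefinable_allnat (A : set U) (V : Type) (l : nat) (P : nat -> (V -> U) -> Prop) :
  (forall i, (i < l)%N -> pdefinable A (P i)) ->
  pdefinable A (fun v => forall i, (i < l)%N -> P i v).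
Proof.
move=> dP; apply: (pdefinable_ext (@pdefinable_allseq _ _ A V nat (iota 0 l) P _)).
  by move=> i; rewrite mem_iota; exact: dP.
by move=> v; split=> H i il; apply: H; rewrite ?mem_iota// in il *.
Qed.

Lemma definable_formula_rel (V : Type) (g : 'I_m -> V) :
  definable (fun z : 'I_n + V -> U => formula_rel phi (z \o inl) (z \o inr \o g)).
Proof.
pose r (x : 'I_n + 'I_m) : 'I_n + V :=
  match x with inl i => inl i | inr j => inr (g j) end.
apply: (definable_ext (definable_rename r (definable_eval U phi))) => z.
rewrite /formula_rel; have -> // : tuple_join (z \o inl) (z \o inr \o g) = z \o r.
by apply: funext => -[].
Qed.

Lemma pdefinable_formula_rel (A : set U) (V : Type) (c : 'I_m -> U) :
  (forall j, A (c j)) ->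
  pdefinable A (fun z : 'I_n + V -> U => formula_rel phi (z \o inl) c).
Proof.
move=> Ac; have dphi := definable_pdefinable A (definable_eval U phi).
exact: (pdefinable_rename inl (pdefinable_subst Ac dphi)).
Qed.

End Common.

Section Ultrapower.
Context (L : language) (K : Type) (U : structure L).
Hypotheses (K_lim : strong_limit K) (U_sat : saturated K U).
Context (F : set (set nat)) (F_ult : nonprincipal F).

(** The universe of the ultrapower of [M] by the [k]-fold product of [F] is
realized in [U] over [M]. *)
Lemma ultrapower_embedding (M : set U) (k : nat) : small K M ->
  exists h : ((nat -> nat) -> {x | M x}) -> U,
    forall P : (((nat -> nat) -> {x | M x}) -> U) -> Prop, pdefinable M P ->
      P h <-> most F k (fun w => P (fun d => sval (d w))).
Proof.
move=> sM; pose X : Type := (nat -> nat) -> {x | M x}.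
pose ev (w : nat -> nat) (d : X) : U := sval (d w).
pose I := {P : (X -> U) -> Prop | pdefinable M P /\ most F k (P \o ev)}.
have sX : small K [set: X].
  have tn := smallT_nat K_lim.
  apply: smallT_fun => //; try exact: smallT_fun.
  exact: (small_sig K M).1 sM.
have [|s|h hh] := compactness K_lim U_sat (X := X) (I := I) (G := sval) sX sM.
- by move=> [P []].
- have [w hw] := most_ex F_ult (most_allseq F_ult (s := s)
    (P := fun (i : {classic I}) w => (sval (i : I)) (ev w)) (fun i _ => (svalP i).2)).
  by exists (ev w).
have hP (P : (X -> U) -> Prop) : pdefinable M P -> most F k (P \o ev) -> P h.
  by move=> dP mP; exact: (hh (exist _ P (conj dP mP))).
exists h => P dP; split=> [Ph|]; last exact: hP.
apply: contrapT => /(most_not F_ult) nP.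
by have := hP _ (pdefinable_not dP) nP.
Qed.

Section Embedded.
Context (M : set U) (k : nat) (h : ((nat -> nat) -> {x | M x}) -> U).
Hypothesis los : forall P : (((nat -> nat) -> {x | M x}) -> U) -> Prop,
  pdefinable M P -> P h <-> most F k (fun w => P (fun d => sval (d w))).

(** The elements of the embedded ultrapower that depend on one coordinate only:
a copy of the ultrapower of [M] by [F] itself. *)
Definition coordinate_model (al : nat) : set U :=
  range (fun e : nat -> {x | M x} => h (fun w => e (w al))).

Lemma los_const (c : {x | M x}) : h (fun=> c) = sval c.
Proof.
pose P (v : ((nat -> nat) -> {x | M x}) -> U) := v (fun=> c) = sval c.
apply: (los (P := P) _).2; last exact: most_all.
exists (fun v => v (inl (fun=> c)) = v (inr c)); split=> //.
exact: definable_eq.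
Qed.

Lemma coordinate_model_sub (al : nat) : M `<=` coordinate_model al.
Proof.
move=> x Mx; exists (fun=> exist _ x Mx) => //.
exact: (los_const (exist _ x Mx)).
Qed.

(** Witnesses are chosen in [M] at each index of the coordinate; their limit is
a witness in the ultrapower. *)
Lemma coordinate_model_tv (al : nat) :
  tarski_vaught M -> tarski_vaught (coordinate_model al).
Proof.
move=> [[x0 Mx0] tv]; split; first by exists x0; exact: coordinate_model_sub.
move=> P [Q [dQ hQ]] [u Pu].
pose N := coordinate_model al.
have he (c : {x | N x}) : exists e : nat -> {x | M x}, h (fun w => e (w al)) = sval c.
  by have [e _] := svalP c; exists e.
have [e hec] := choice he.
pose Qn (n : nat) (v : unit -> U) := Q (tuple_join v (fun c => sval (e c n))).
have wit n : exists x : {x | M x}, (exists v, Qn n v) -> Qn n (fun=> sval x).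
  have [Hn|Hn] := pselect (exists v, Qn n v); last by exists (exist _ x0 Mx0).
  have dn : pdefinable M (Qn n).
    pose r (z : unit + {x | N x}) : unit + {x | M x} :=
      match z with inl t => inl t | inr c => inr (e c n) end.
    exists (fun v => Q (v \o r)); split; first exact: definable_rename.
    move=> v; rewrite /Qn; have -> // : tuple_join v (fun c => sval (e c n)) =
      tuple_join v sval \o r by apply: funext => -[].
  have [v [Mv Qv]] := tv _ dn Hn; exists (exist _ (v tt) Mv) => _.
  by rewrite /= (_ : (fun=> v tt) = v)//; apply: funext => -[].
have [y hy] := choice wit.
exists (fun=> h (fun w => y (w al))); split; first by exists y.
apply/hQ.
pose r (z : unit + {x | N x}) : (nat -> nat) -> {x | M x} :=
  match z with inl t => fun w => y (w al) | inr c => fun w => e c (w al) end.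
have Er : tuple_join (fun=> h (fun w => y (w al))) sval = h \o r.
  by apply: funext => -[t|c] //=; rewrite hec.
have dr : pdefinable M (fun v => Q (v \o r)).
  exact/definable_pdefinable/definable_rename.
rewrite Er; apply: (los dr).2.
(* At most indices a witness exists, because one exists for the limit. *)
pose r' (z : {x | N x}) : (nat -> nat) -> {x | M x} := fun w => e z (w al).
have dE : pdefinable M (fun v => exists u : unit -> U, Q (tuple_join u (v \o r'))).
  exact: (pdefinable_rename r' (definable_pdefinable M (definable_exV dQ))).
have : exists u : unit -> U, Q (tuple_join u (h \o r')).
  have -> : h \o r' = sval by apply: funext => c; exact: hec.
  by exists u; apply/hQ.
move=> /(los dE).1; apply: most_sub => // w [v Qv].
have := hy (w al) (ex_intro _ v Qv); rewrite /Qn.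
set z := tuple_join _ _; have -> // : z = (fun d : _ -> {x | M x} => sval (d w)) \o r.
by apply: funext => -[].
Qed.

End Embedded.

(** * Dividing along limits of sequences in a countably saturated submodel *)

(** If all the sets of instances [psi(x, delta_i)] were consistent, one could
replace the [delta_i] one at a time, starting from the innermost quantifier, by
an inconsistent row witnessing that [psi(x, d)] divides. Countable
saturation brings the rows back into [M], where the type of [d] controls the
next replacement. The array obtained has inconsistent rows and consistent
paths, which a dependent formula does not allow. *)
Lemma dividing_limit (n m : nat) (psi : formula L ('I_n + 'I_m)) (M : set U)
    (delta : nat -> 'I_m -> U) (d : 'I_m -> U) :
  NIP U psi -> countably_saturated M -> (forall i j, M (delta i j)) ->
  (forall P : ('I_m -> U) -> Prop, pdefinable M P ->
     F [set i | P (delta i)] -> P d) ->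
  formula_divides M (PForm psi d) ->
  exists N, most F N (fun w =>
    ~ exists x, forall i, (i < N)%N -> formula_rel psi x (delta (w i))).
Proof.
move=> nip [_ satM] Md hd [k [c [cM cinc]]].
apply: contrapT => /forallNP H.
have {}H N : most F N (fun w => exists x, forall i, (i < N)%N -> formula_rel psi x (delta (w i))).
  by apply: contrapT => /(most_not F_ult); exact: H.
have [D] := NIP_dual K_lim U_sat nip; apply.
apply: (@tree_property_shatters _ _ (formula_rel psi) k) => N.
pose rowinc (e : nat -> 'I_m -> U) := forall i : 'I_k -> nat, injective i ->
  ~ exists x, forall j, formula_rel psi x (e (i j)).
suff claim r : (r <= N)%N -> exists e : nat -> nat -> 'I_m -> U,
    [/\ forall s j i, (s < r)%N -> M (e s j i), forall s, (s < r)%N -> rowinc (e s) &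
    forall f : nat -> nat, most F (N - r) (fun w => exists x,
      (forall i, (i < N - r)%N -> formula_rel psi x (delta (w i))) /\
      forall s, (s < r)%N -> formula_rel psi x (e s (f s)))].
  have [e [_ inc path]] := claim N (leqnn N); exists e; split=> // f.
  by have := path f; rewrite subnn => -[x [_ hx]]; exists x.
elim: r => [_|r IH rN].
  have [u0] := carrier_inhabited U.
  exists (fun _ _ _ => u0); split=> // f; rewrite subn0.
  by apply: most_sub (H N) => // w [x hx]; exists x.
have [e [Me inc path]] := IH (ltnW rN).
set l := (N - r.+1)%N.
have El : (N - r = l.+1)%N by rewrite /l subnSK.
rewrite El in path.
(* The new row is the sequence witnessing that [psi(x, d)] divides. *)
pose e1 s := if s == r then c else e s.
have inc1 s : (s < r.+1)%N -> rowinc (e1 s).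
  rewrite ltnS leq_eqVlt /e1; case: eqVneq => [_ _|_ /= sr]; last exact: inc.
  by move=> i iinj [x hx]; apply: (cinc i iinj); exists x.
have path1 (f : nat -> nat) : most F l (fun w => exists x,
    (forall i, (i < l)%N -> formula_rel psi x (delta (w i))) /\
    forall s, (s < r.+1)%N -> formula_rel psi x (e1 s (f s))).
  have /= := path f; apply: most_sub => // w Fw.
  pose Q (z : 'I_n + 'I_m -> U) := (forall i, (i < l)%N -> formula_rel psi (z \o inl) (delta (w i)))
    /\ formula_rel psi (z \o inl) (z \o inr \o id) /\
    forall s, (s < r)%N -> formula_rel psi (z \o inl) (e s (f s)).
  pose P (y : 'I_m -> U) := exists x, Q (tuple_join x y).
  have dP : pdefinable M P.
    apply: pdefinable_exV; apply: pdefinable_and.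
      by apply: pdefinable_allnat => i _; apply: pdefinable_formula_rel => j.
    apply: pdefinable_and; first exact/definable_pdefinable/definable_formula_rel.
    by apply: pdefinable_allnat => s sr; apply: pdefinable_formula_rel => j; exact: Me.
  have Pd : P d.
    apply: hd => //; apply: ult_sub Fw => // i [x [hx1 hx2]]; exists x.
    split; last split=> //.
      by move=> j jl; have := hx1 j (ltnW jl); rewrite /upd (ltn_eqF jl).
    by have := hx1 l (ltnSn l); rewrite /upd eqxx.
  have [x [hx1 [hx2 hx3]]] := (same_type_pdefinable (cM (f r)) dP).2 Pd.
  exists x; split=> // s; rewrite ltnS leq_eqVlt /e1.
  by case: eqVneq => [->|_ /= sr] //; exact: hx3.
(* The whole array is moved back into [M] over the sequence [delta]. *)
have [z [Mz hz]] := satM (nat * 'I_m)%type (nat * nat * 'I_m)%type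
  (fun z => delta z.1 z.2) (fun z => e1 z.1.1 z.1.2 z.2) (fun z => Md z.1 z.2).
exists (fun s j i => z (s, j, i)); split=> //.
- move=> s sr i iinj.
  pose Q (v : nat * nat * 'I_m + nat * 'I_m -> U) := ~ exists x : 'I_n -> U,
    forall j, formula_rel psi (tuple_join x v \o inl)
      (tuple_join x v \o inr \o (fun i' => inl (s, i j, i'))).
  have dQ : definable Q.
    apply: definable_not.
    apply: (definable_exV (P := fun y => forall j, formula_rel psi (y \o inl)
      (y \o inr \o (fun i' => inl (s, i j, i'))))).
    by apply: definable_allfin => j; exact: definable_formula_rel.
  exact: (hz Q dQ (inc1 s sr i iinj)).
- move=> f; apply: most_sub (path1 f) => // w.
  pose Q (v : nat * nat * 'I_m + nat * 'I_m -> U) := exists x : 'I_n -> U,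
    (forall i, (i < l)%N -> formula_rel psi (tuple_join x v \o inl)
      (tuple_join x v \o inr \o (fun i' => inr (w i, i')))) /\
    (forall s, (s < r.+1)%N -> formula_rel psi (tuple_join x v \o inl)
      (tuple_join x v \o inr \o (fun i' => inl (s, f s, i')))).
  have dQ : definable Q.
    apply: (definable_exV (P := fun y =>
      (forall i, (i < l)%N -> formula_rel psi (y \o inl)
        (y \o inr \o (fun i' => inr (w i, i')))) /\
      (forall s, (s < r.+1)%N -> formula_rel psi (y \o inl)
        (y \o inr \o (fun i' => inl (s, f s, i')))))).
    by apply: definable_and; apply: definable_allnat => i _; exact: definable_formula_rel.
  exact: (hz Q dQ).
Qed.

End Ultrapower.

(** * From an inp-pattern to an inp-pattern of dependent formulas *)

Section Pattern.
Context (L : language) (K : Type) (U : structure L).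
Hypotheses (K_lim : strong_limit K) (U_sat : saturated K U).
Context (C : set U) (C_small : small K C).
Context (n : nat) (p : set (pformula U 'I_n)) (pC : p `<=` params_in C).

Definition realizes (a : 'I_n -> U) : Prop := forall psi, p psi -> sat a psi.

Let member : Type := {psi | p psi}.
Let part : Type := seq {classic member}.

Definition sat_part (D : part) (a : 'I_n -> U) : Prop :=
  forall psi : {classic member}, psi \in D -> sat a (sval (psi : member)).

Lemma sat_part_pdefinable (A : set U) (D : part) :
  C `<=` A -> pdefinable A (sat_part D).
Proof.
move=> CA; apply: pdefinable_allseq => psi _; apply: (pdefinable_sub CA).
by apply: sat_pdefinable; apply: pC; exact: svalP.
Qed.

Section Rows.
Context (k : nat) (l : 'I_k -> nat) (psi : forall al, formula L ('I_n + 'I_(l al))).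

Definition instances (c : forall al, 'I_(l al) -> U) (a : 'I_n -> U) : Prop :=
  forall al, formula_rel (psi al) a (c al).

Lemma ex_sat_part_pdefinable (D : part) :
  pdefinable C (fun v : {al & 'I_(l al)} -> U =>
    exists x, sat_part D x /\ instances (fun al j => v (Tagged _ j)) x).
Proof.
apply: (pdefinable_exV (P := fun z => sat_part D (z \o inl) /\
  forall al, formula_rel (psi al) (z \o inl)
    (z \o inr \o (fun j => Tagged (fun al => 'I_(l al)) j)))).
apply: pdefinable_and.
  exact: (pdefinable_rename inl (sat_part_pdefinable D (@subset_refl _ C))).
by apply: pdefinable_allfin => al; exact/definable_pdefinable/definable_formula_rel.
Qed.

Lemma realize_instances (c : forall al, 'I_(l al) -> U) :
  (forall D : part, exists x, sat_part D x /\ instances c x) ->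
  exists a, realizes a /\ instances c a.
Proof.
move=> H; pose c' (z : {al & 'I_(l al)}) : U := c (tag z) (tagged z).
pose A := C `|` range c'.
have sA : small K A by apply: small_setU => //; apply: small_range; exact: smallT_count.
pose R (i : option member) (a : 'I_n -> U) : Prop :=
  if i is Some chi then sat a (sval chi) else instances c a.
have [[chi|]|s|a ha] := saturated_pdefinable U_sat (R := R) sA.
- apply: (pdefinable_sub (A := C)); first by move=> ? ?; left.
  by apply: sat_pdefinable; apply: pC; exact: svalP.
- apply: pdefinable_allfin => al.
  apply: (pdefinable_subst _ (definable_pdefinable _ (definable_eval U (psi al)))).
  by move=> j; right; exists (Tagged (fun al => 'I_(l al)) j).
- have [x [hx cx]] := H (pmap (fun o : {classic option member} =>
    (o : option member) : option {classic member}) s).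
  exists x => -[chi|//] chis; apply: hx.
  by rewrite mem_pmap; apply/mapP; exists (Some chi).
exists a; split=> [chi pchi|]; last exact: (ha None).
exact: (ha (Some (exist _ chi pchi))).
Qed.

End Rows.

Section Array.
Context (F : set (set nat)) (F_ult : nonprincipal F).

(** An array is read off a product of ultrafilters: each row takes its
entries from its own block of one long increasing sequence of indices, so that both a path and a segment of a row are
subsequences of it. *)
Lemma array_of_limits (k : nat) (l : 'I_k -> nat)
    (psi : forall al, formula L ('I_n + 'I_(l al)))
    (delta : forall al, nat -> 'I_(l al) -> U) (N : 'I_k -> nat) :
  (forall D : part, most F k (fun w => exists x,
     sat_part D x /\ instances psi (fun al => delta al (w al)) x)) ->
  (forall al, most F (N al) (fun w => ~ exists x,
     forall i, (i < N al)%N -> formula_rel (psi al) x (delta al (w i)))) ->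
  exists d : forall al, nat -> 'I_(l al) -> U,
    (forall f : 'I_k -> nat, exists a,
       realizes a /\ instances psi (fun al => d al (f al)) a) /\
    (forall al (s : nat -> nat), increasing_on (N al) s ->
       ~ exists x, forall i, (i < N al)%N -> formula_rel (psi al) x (d al (s i))).
Proof.
move=> path row.
pose T2 (al : 'I_k) : Type := (nat * 'I_(l al))%type.
pose X : Type := {al : 'I_k & T2 al}.
pose ent (v : X -> U) (al : 'I_k) i (j : 'I_(l al)) : U := v (existT T2 al (i, j)).
pose I : Type := part * ('I_k -> nat) +
  {z : 'I_k * (nat -> nat) | increasing_on (N z.1) z.2}.
pose G (z : I) (v : X -> U) : Prop := match z with
  | inl (D, f) => exists x, sat_part D x /\ instances psi (fun al => ent v al (f al)) x
  | inr (exist (al, s) _) =>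
      ~ exists x, forall i, (i < N al)%N -> formula_rel (psi al) x (ent v al (s i))
  end.
have [||z|s|v hv] := compactness K_lim U_sat (X := X) (A := C) (G := G).
- exact: smallT_count.
- exact: C_small.
- case: z => [[D f]|[[al s] sinc]].
    pose g (z : {al & 'I_(l al)}) : X := existT T2 (tag z) (f (tag z), tagged z).
    exact: (pdefinable_rename g (ex_sat_part_pdefinable psi D)).
  apply: pdefinable_not; apply: definable_pdefinable.
  apply: (definable_exV (P := fun z => forall i, (i < N al)%N -> formula_rel (psi al)
    (z \o inl) (z \o inr \o (fun j => existT T2 al (s i, j))))).
  by apply: definable_allnat => i _; exact: definable_formula_rel.
- pose bd (z : {classic I}) : nat := match (z : I) with
    | inl (D, f) => \max_al f al
    | inr (exist (al, s) _) => \max_(i < N al) s i end.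
  have [B hB] := seq_bound s bd.
  pose vw (w : nat -> nat) (z : X) : U :=
    delta (tag z) (w (tag z * B + (tagged z).1)%N) (tagged z).2.
  suff [w hw] : exists w, forall z : {classic I}, z \in s -> G z (vw w).
    by exists (vw w).
  apply: (most_ex F_ult (L := (k * B)%N)); apply: (most_allseq F_ult) => z zs.
  have := hB z zs; case: z {zs} => [[D f]|[[al t] tinc]] /= hz.
    have fB al : (f al < B)%N by apply: leq_ltn_trans hz; exact: leq_bigmax.
    pose g i := (i * B + (if insub i is Some al then f al else 0))%N.
    have gE (al : 'I_k) : g al = (al * B + f al)%N by rewrite /g valK.
    pose P (w : nat -> nat) := exists x,
      sat_part D x /\ instances psi (fun al => delta al (w al)) x.
    have gB (i : nat) : (i < k)%N -> (i * B <= g i < i.+1 * B)%N.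
      move=> ik; rewrite /g insubT mulSn leq_addr addnC ltn_add2r /=.
      exact: fB.
    have E : most F (k * B) (fun w => P (w \o g)) <-> most F k P.
      apply: (most_restrict F_ult) => [w w' ww' [x [Dx hx]]|i j /andP[ij jk]|i ik].
      - exists x; split=> // al; have := hx al; rewrite /formula_rel; congr eval.
        by rewrite ww'.
      - have /andP[_ hi] := gB _ (ltn_trans ij jk); have /andP[hj _] := gB _ jk.
        by apply: leq_trans hi _; apply: leq_trans hj; rewrite leq_mul2r ij orbT.
      - have /andP[_ hi] := gB _ ik; apply: leq_trans hi _.
        by rewrite leq_mul2r ik orbT.
    have := E.2 (path D); apply: most_sub => // w [x [Dx hx]]; exists x; split=> // al.
    by have := hx al; rewrite /= gE.
  have tB (i : nat) : (i < N al)%N -> (t i < B)%N.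
    by move=> iN; apply: leq_ltn_trans hz; exact: (leq_bigmax (Ordinal iN)).
  pose g i := (al * B + t i)%N.
  pose P (w : nat -> nat) := ~ exists x,
    forall i, (i < N al)%N -> formula_rel (psi al) x (delta al (w i)).
  have E : most F (k * B) (fun w => P (w \o g)) <-> most F (N al) P.
    apply: (most_restrict F_ult) => [w w' ww' Pw [x hx]|i j /andP[ij jN]|i iN].
    - by apply: Pw; exists x => i iN; rewrite ww'//; exact: hx.
    - by rewrite /g ltn_add2l; apply: tinc; rewrite ij.
    - apply: (@leq_trans (al.+1 * B)); first by rewrite /g mulSn addnC ltn_add2r tB.
      by rewrite leq_mul2r ltn_ord orbT.
  exact: E.2 (row al).
exists (fun al i j => ent v al i j); split=> [f|al s sinc].
  by apply: realize_instances => D; exact: (hv (inl (D, f))).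
exact: (hv (inr (exist _ (al, s) sinc))).
Qed.

End Array.

End Pattern.

Section Dependent.
Context (L : language) (K : Type) (U : structure L).
Hypotheses (K_lim : strong_limit K) (U_sat : saturated K U).
Hypotheses (sf : small K [set: fsym L]) (sr : small K [set: rsym L]).
Hypothesis T_dd : dependent_dividing K U.

Section Ultra.
Context (F : set (set nat)) (F_ult : nonprincipal F).

Lemma most_coordinate (k al : nat) (P : nat -> Prop) : (al < k)%N ->
  most F k (fun w => P (w al)) <-> F [set i | P i].
Proof.
move=> alk; have := @most_restrict F F_ult k 1 (fun=> al) (fun w => P (w 0)).
apply=> [w w' ww'|i j /andP[ij]|//]; first by rewrite ww'.
by rewrite ltnS leqn0 => /eqP j0; rewrite j0 in ij.
Qed.

Lemma ult_sequence (P : set nat) : F P ->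
  exists g : nat -> nat, injective g /\ forall j, P (g j).
Proof.
move=> FP.
have next i : exists j, P j /\ (i < j)%N.
  have [j [Pj ij]] := ult_ex F_ult (ult_and F_ult FP (ult_large F_ult i)).
  by exists j.
have [nx hnx] := choice next.
pose g j := iter j.+1 nx 0; exists g; split; last by move=> j; exact: (hnx _).1.
have gS j : (g j < g j.+1)%N by exact: (hnx _).2.
have ginc i j : (i < j)%N -> (g i < g j)%N.
  elim: j => // j IH; rewrite ltnS leq_eqVlt => /orP[/eqP->//|/IH ij].
  exact: ltn_trans ij (gS j).
move=> i j E; have [ij|ij|//] := ltngtP i j.
  by have := ginc _ _ ij; rewrite E ltnn.
by have := ginc _ _ ij; rewrite E ltnn.
Qed.

(** An instance whose parameter realizes the limit of a row divides: every
formula over [M] true of the parameter holds at infinitely many entries. *)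
Lemma limit_divides (n m : nat) (phi : formula L ('I_n + 'I_m)) (M : set U)
    (b : nat -> 'I_m -> U) (d : 'I_m -> U) (k : nat) : small K M ->
  k_inconsistent k (fun i => PForm phi (b i)) ->
  (forall P : ('I_m -> U) -> Prop, pdefinable M P -> P d -> F [set i | P (b i)]) ->
  formula_divides M (PForm phi d).
Proof.
move=> sM inc hd.
pose X : Type := (nat * 'I_m)%type.
pose I : Type := nat * {P : ('I_m -> U) -> Prop | pdefinable M P /\ P d} +
  {i : 'I_k -> nat | injective i}.
pose G (z : I) (v : X -> U) : Prop := match z with
  | inl (j, P) => sval P (fun t => v (j, t))
  | inr i => ~ exists x, forall j, formula_rel phi x (fun t => v (sval i j, t)) end.
have [||z|s|v hv] := compactness K_lim U_sat (X := X) (A := M) (G := G).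
- exact: smallT_count.
- exact: sM.
- case: z => [[j [P [dP Pd]]]|[i iinj]] /=.
    exact: (pdefinable_rename (pair j) dP).
  apply: pdefinable_not; apply: definable_pdefinable.
  apply: (definable_exV (P := fun z => forall j, formula_rel phi (z \o inl)
    (z \o inr \o pair (i j)))).
  by apply: definable_allfin => j; exact: definable_formula_rel.
- have FS : F [set i | forall z : {classic I}, z \in s ->
      if (z : I) is inl (j, P) then sval P (b i) else True].
    elim: s => [|z s IH]; first by apply: ult_sub (ult_large F_ult 0).
    have Fz : F [set i | if (z : I) is inl (j, P) then sval P (b i) else True].
      case: z => [[j [P [dP Pd]]]|_] /=; first exact: hd.
      by apply: ult_sub (ult_large F_ult 0).
    apply: ult_sub (ult_and F_ult Fz IH) => // i [h1 h2] y.
    by rewrite inE => /orP[/eqP->//|]; exact: h2.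
  have [g [ginj hg]] := ult_sequence FS.
  exists (fun z => b (g z.1) z.2) => z zs; have hz t := hg t z zs.
  case: z {zs} hz => [[j P] /(_ j)//|[i iinj] _] /= -[x hx].
  by apply: (inc (g \o i) (inj_comp ginj iinj)); exists x.
exists k, (fun j t => v (j, t)); split=> [j psi Mpsi|i iinj].
  have H (P : ('I_m -> U) -> Prop) : pdefinable M P -> P d -> P (fun t => v (j, t)).
    by move=> dP Pd; exact: (hv (inl (j, exist _ P (conj dP Pd)))).
  have dsat := sat_pdefinable Mpsi.
  split=> [h|]; last exact: (H _ dsat).
  by apply: contrapT => nd; exact: (H _ (pdefinable_not dsat) nd h).
exact: (hv (inr (exist _ i iinj))).
Qed.

End Ultra.

Context (C : set U) (C_small : small K C).
Context (n : nat) (p : set (pformula U 'I_n)) (pC : p `<=` params_in C).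

(** The rows are realized in an ultrapower of a countably saturated submodel
[M]; if [a] satisfies the path through the limits [beta al] of the rows, then
its type over the [al]-th coordinate ultrapower divides over [M] because of
[phi al], so dependent dividing provides a dependent formula whose parameter is
again the limit of a sequence in [M]. *)
Lemma dependent_array (k : nat) (m : 'I_k -> nat)
    (phi : forall al, formula L ('I_n + 'I_(m al)))
    (b : forall al, nat -> 'I_(m al) -> U) (r : 'I_k -> nat) :
  (forall al, k_inconsistent (r al) (fun i => PForm (phi al) (b al i))) ->
  (forall (f : 'I_k -> nat) (D : seq {classic {psi | p psi}}),
     exists x, sat_part D x /\ instances phi (fun al => b al (f al)) x) ->
  exists (l : 'I_k -> nat) (psi : forall al, formula L ('I_n + 'I_(l al)))
    (d : forall al, nat -> 'I_(l al) -> U) (N : 'I_k -> nat),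
    [/\ forall al, NIP U (psi al),
        forall f : 'I_k -> nat, exists a,
          realizes p a /\ instances psi (fun al => d al (f al)) a
      & forall al (s : nat -> nat), increasing_on (N al) s ->
          ~ exists x, forall i, (i < N al)%N -> formula_rel (psi al) x (d al (s i))].
Proof.
move=> rows paths; have [F F_ult] := nonprincipal_exists.
pose T2 (al : 'I_k) : Type := (nat * 'I_(m al))%type.
pose M0 := C `|` range (fun z : {al & T2 al} => b (tag z) (tagged z).1 (tagged z).2).
have sM0 : small K M0.
  by apply: small_setU => //; apply: small_range; exact: smallT_count.
have [M [sM M0M satM]] := countably_saturated_exists K_lim sf sr sM0.
have CM : C `<=` M by move=> x Cx; apply: M0M; left.
have tvM := countably_saturated_tv satM.
have [h los] := ultrapower_embedding K_lim U_sat F_ult k sM.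
have bM al i j : M (b al i j) by apply: M0M; right; exists (existT T2 al (i, j)).
pose bs al i j : {x | M x} := exist _ (b al i j) (bM al i j).
have losV (V : Type) (g : V -> (nat -> nat) -> {x | M x}) (P : (V -> U) -> Prop) :
    pdefinable M P -> P (h \o g) <-> most F k (fun w => P (fun v => sval (g v w))).
  by move=> dP; exact: (los _ (pdefinable_rename g dP)).
pose beta al j := h (fun w => bs al (w al) j).
have [a [pa phia]] : exists a, realizes p a /\ instances phi beta a.
  apply: (realize_instances K_lim U_sat C_small pC) => D.
  have dP := pdefinable_sub CM (ex_sat_part_pdefinable pC phi D).
  pose g (z : {al & 'I_(m al)}) (w : nat -> nat) := bs (tag z) (w (tag z)) (tagged z).
  apply/(losV _ g _ dP); apply: most_all => // w.
  exact: (paths (fun al => w al) D).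
have step (al : 'I_k) : exists l : nat, exists (psi : formula L ('I_n + 'I_l))
    (e : nat -> 'I_l -> {x | M x}), [/\ NIP U psi,
      formula_rel psi a (fun j => h (fun w => e (w al) j)) &
      formula_divides M (PForm psi (fun j => h (fun w => e (w al) j)))].
  pose N := coordinate_model h al.
  have MN : M `<=` N by exact: (coordinate_model_sub F_ult los al).
  have tvN : tarski_vaught N by exact: (coordinate_model_tv F_ult los al tvM).
  have sN : small K N.
    apply: small_range; apply: smallT_fun => //; first exact: smallT_nat.
    exact: (small_sig K M).1 sM.
  pose q := [set chi : pformula U 'I_n | params_in N chi /\ sat a chi].
  have qN : complete_type_over N q.
    split; first split=> [chi []//|D _ Dq].
      by exists a => chi /Dq[].
    move=> chi Nchi; have [sc|sc] := pselect (sat a chi); first by left.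
    by right; split.
  have qdiv : type_divides M q.
    exists (PForm (phi al) (beta al)); split.
      exists [set PForm (phi al) (beta al)]; split.
      - exact: finite_set1.
      - move=> _ ->; split; last exact: phia.
        by move=> j; exists (fun i => bs al i j).
      - by move=> x /(_ _ erefl).
    apply: (limit_divides F_ult sM (rows al)) => P dP Pbeta.
    apply/(most_coordinate F_ult (fun i => P (b al i)) (ltn_ord al)).
    exact: (losV _ (fun j w => bs al (w al) j) P dP).1 Pbeta.
  have [l [psi [c [nip Nc [_ pc] cdiv]]]] := T_dd sM sN
    (tarski_vaught_elementary tvM) (tarski_vaught_elementary tvN) MN qN qdiv.
  have he j : exists e : nat -> {x | M x}, h (fun w => e (w al)) = c j.
    by have [e _] := Nc j; exists e.
  have [e hec] := choice he.
  exists l, psi, (fun i j => e j i).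
  have -> : (fun j => h (fun w => e j (w al))) = c by apply: funext.
  by [].
pose l al := projT1 (cid (step al)).
pose hl al := projT2 (cid (step al)).
pose psi al : formula L ('I_n + 'I_(l al)) := projT1 (cid (hl al)).
pose hpsi al := projT2 (cid (hl al)).
pose e al : nat -> 'I_(l al) -> {x | M x} := projT1 (cid (hpsi al)).
have he al : [/\ NIP U (psi al),
    formula_rel (psi al) a (fun j => h (fun w => e al (w al) j)) &
    formula_divides M (PForm (psi al) (fun j => h (fun w => e al (w al) j)))].
  exact: (projT2 (cid (hpsi al))).
pose delta al i j : U := sval (e al i j).
have row al : exists N, most F N (fun w => ~ exists x,
    forall i, (i < N)%N -> formula_rel (psi al) x (delta al (w i))).
  have [nip _ div] := he al.
  apply: (dividing_limit K_lim U_sat F_ult nip satM _ _ div) => [i j|P dP FP].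
    exact: svalP.
  apply/(losV _ (fun j w => e al (w al) j) P dP).
  exact: (most_coordinate F_ult (fun i => P (delta al i)) (ltn_ord al)).2.
have [N hN] := choice row.
have path (D : seq {classic {psi | p psi}}) : most F k (fun w => exists x,
    sat_part D x /\ instances psi (fun al => delta al (w al)) x).
  have dP := pdefinable_sub CM (ex_sat_part_pdefinable pC psi D).
  pose g (z : {al & 'I_(l al)}) (w : nat -> nat) := e (tag z) (w (tag z)) (tagged z).
  apply: (losV _ g _ dP).1; exists a; split=> [chi _|al].
    by apply: pa; exact: svalP.
  by have [] := he al.
have [d [hd1 hd2]] := array_of_limits K_lim U_sat C_small pC F_ult path hN.
by exists l, psi, d, N; split=> // al; have [] := he al.
Qed.

End Dependent.

(** * Indiscernible sequences *)

Section Limits.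
Context (L : language) (K : Type) (U : structure L).
Hypotheses (K_lim : strong_limit K) (U_sat : saturated K U).
Context (C : set U) (C_small : small K C).

Lemma increasing_ord (l B : nat) (i : 'I_l -> nat) :
  {homo i : s t / (s < t)%N >-> (s < t)%N} -> (forall t, (i t < B)%N) ->
  exists g : nat -> nat, [/\ increasing_on l g, forall t : 'I_l, g t = i t &
    forall t, (t < l)%N -> (g t < B)%N].
Proof.
move=> inc iB; exists (fun t => if insub t is Some t' then i t' else 0).
have E (t : 'I_l) : (if insub (val t) is Some t' then i t' else 0) = i t by rewrite valK.
split=> // [s t /andP[st tl]|t tl].
  rewrite (E (Ordinal (ltn_trans st tl))) (E (Ordinal tl)); exact: inc.
by rewrite (E (Ordinal tl)).
Qed.

Definition coord_depends (m l : nat) (P : (nat * 'I_m -> U) -> Prop) : Prop :=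
  forall v v' : nat * 'I_m -> U,
    (forall i j, (i < l)%N -> v (i, j) = v' (i, j)) -> P v -> P v'.

(** The sequence realizes the iterated limit of [J]: it inherits every property
over [C] shared by the increasing subsequences of [J]. *)
Lemma extract_indiscernible (m : nat) (J : nat -> 'I_m -> U) :
  exists I : nat -> 'I_m -> U, indiscernible C I /\
    forall l (P : (nat * 'I_m -> U) -> Prop), pdefinable C P -> coord_depends l P ->
      (forall w, increasing_on l w -> P (fun z => J (w z.1) z.2)) ->
      P (fun z => I z.1 z.2).
Proof.
have [F F_ult] := nonprincipal_exists.
pose X : Type := (nat * 'I_m)%type.
pose Jw (w : nat -> nat) (z : X) : U := J (w z.1) z.2.
pose G := {z : nat * ((X -> U) -> Prop) |
  [/\ pdefinable C z.2, coord_depends z.1 z.2 & most F z.1 (z.2 \o Jw)]}.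
have dJ l (P : (X -> U) -> Prop) : coord_depends l P -> depends l (P \o Jw).
  by move=> dP w w' ww'; apply: dP => i j il; rewrite /Jw /= ww'.
have [||z|s|v hv] := compactness K_lim U_sat (X := X) (A := C)
    (G := fun (z : G) => (sval z).2).
- exact: smallT_count.
- exact: C_small.
- by case: z => z [].
- have [B hB] := seq_bound s (fun z : G => (sval z).1).
  have [z zs|w hw] := most_ex F_ult (L := B) (most_allseq F_ult (s := s)
    (P := fun (z : {classic G}) w => (sval (z : G)).2 (Jw w)) _).
    have := hB z zs; case: z {zs} => [[l P] [dP cP mP]] /= lB.
    apply/(most_restrict F_ult (g := id) (dJ _ _ cP)) => //.
      by move=> i j /andP[].
    by move=> i il; exact: ltn_trans il lB.
  by exists (Jw w).
have hP l P : pdefinable C P -> coord_depends l P -> most F l (P \o Jw) -> P v.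
  by move=> dP cP mP; exact: (hv (exist _ (l, P) (And3 dP cP mP))).
have hPE l P : pdefinable C P -> coord_depends l P -> P v <-> most F l (P \o Jw).
  move=> dP cP; split=> [Pv|]; last exact: hP.
  apply: contrapT => /(most_not F_ult) nP.
  have cnP : coord_depends l (fun v => ~ P v).
    by move=> u u' uu' nPu Pu'; apply: nPu; apply: cP Pu' => i j il; rewrite uu'.
  exact: (hP _ _ (pdefinable_not dP) cnP nP Pv).
exists (fun i j => v (i, j)).
have vE : (fun z : X => v (z.1, z.2)) = v by apply: funext => -[].
split; last first.
  move=> l P dP cP H; rewrite /= vE; apply: (hP _ _ dP cP).
  by apply: most_sub (most_increasing F_ult l) => // w; exact: H.
split; first exact: infinite_nat.
move=> l i j iinc jinc psi Cpsi.
suff H (r : 'I_l -> nat) : {homo r : s t / (s < t)%N >-> (s < t)%N} ->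
    sat (fun st => v (r st.1, st.2)) psi <->
    most F l (fun w => sat (fun st : 'I_l * 'I_m => J (w st.1) st.2) psi).
  by rewrite (H i)// (H j).
move=> rinc.
have [g [ginc gE gB]] := increasing_ord rinc (B := (\max_t r t).+1)
  (fun t => leq_bigmax t).
pose P (u : X -> U) := sat (fun st : 'I_l * 'I_m => u (r st.1, st.2)) psi.
have dP : pdefinable C P.
  exact: (pdefinable_rename (fun st : 'I_l * 'I_m => (r st.1, st.2)) (sat_pdefinable Cpsi)).
have cP : coord_depends (\max_t r t).+1 P.
  move=> u u' uu'; rewrite /P; set a := (X in sat X _ -> _); set a' := (X in _ -> sat X _).
  suff -> : a = a' by [].
  by apply: funext => st; apply: uu'; rewrite ltnS; exact: leq_bigmax.
rewrite -[X in X <-> _]/(P v) (hPE _ _ dP cP).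
pose Q w := sat (fun st : 'I_l * 'I_m => J (w (val st.1)) st.2) psi.
have dQ : depends l Q.
  move=> w w' ww'; rewrite /Q.
  have -> // : (fun st : 'I_l * 'I_m => J (w (val st.1)) st.2) =
    (fun st => J (w' (val st.1)) st.2).
  by apply: funext => st; rewrite ww'//; exact: ltn_ord.
rewrite -(most_restrict F_ult dQ ginc gB); apply: most_ext => // w.
rewrite /Q /P /Jw /=.
have -> // : (fun st : 'I_l * 'I_m => J (w (g (val st.1))) st.2) =
    (fun st => J (w (r st.1)) st.2).
by apply: funext => st; rewrite gE.
Qed.

End Limits.

(** * Counting [phi]-types *)

Section PhiTypes.
Context (L : language) (K : Type) (U : structure L).
Hypotheses (K_lim : strong_limit K) (U_sat : saturated K U).
Context (C : set U) (C_small : small K C).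
Context (n m : nat) (p : set (pformula U 'I_n)) (pC : p `<=` params_in C).
Context (phi : formula L ('I_n + 'I_m)) (A : set ('I_m -> U)).

Definition phi_type_of (a : 'I_n -> U) : set (pformula U 'I_n) :=
  [set chi | phi_instances phi A chi /\ sat a chi].

Lemma phi_type_ofP (a : 'I_n -> U) (b : 'I_m -> U) : A b ->
  phi_type_of a (PForm phi b) <-> formula_rel phi a b.
Proof.
move=> Ab; split=> [[]//|h]; split=> //.
by left; exists b.
Qed.

Lemma phi_type_of_eq (a a' : 'I_n -> U) :
  phi_type_of a = phi_type_of a' <-> forall b, A b -> formula_rel phi a b <-> formula_rel phi a' b.
Proof.
split=> [E b Ab|H]; first by rewrite -!phi_type_ofP// E.
have sub (x y : 'I_n -> U) : (forall b, A b -> formula_rel phi x b <-> formula_rel phi y b) ->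
    phi_type_of x `<=` phi_type_of y.
  move=> xy _ [[[b Ab <-]|[b Ab <-]] h]; split; try by [left; exists b|right; exists b].
    exact: (xy b Ab).1 h.
  by move=> /(xy b Ab).2; exact: h.
by apply/seteqP; split; apply: sub => b Ab; rewrite H.
Qed.

(** A [phi]-type consistent with [p] is realized together with [p] by
saturation, and is then all of the [phi]-type of its realization by maximality.
*)
Lemma phi_types_realized : small K [set u | exists b, A b /\ exists j, b j = u] ->
  phi_types p phi A = [set phi_type_of a | a in realizes p].
Proof.
move=> sA; apply/seteqP; split=> [q [[qA qc qmax] qpc]|_ [a pa <-]].
  pose B := C `|` [set u | exists b, A b /\ exists j, b j = u].
  have [||a Ha] := U_sat (A := B) (p := q `|` p); first exact: small_setU.
    split=> // chi [/qA[[b Ab <-]|[b Ab <-]]|/pC Cchi] i; last by left; exact: Cchi.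
      by right; exists b; split=> //; exists i.
    by right; exists b; split=> //; exists i.
  exists a; first by move=> chi pchi; apply: Ha; right.
  apply: qmax => [chi []//|D _ Dq|chi qchi]; first by exists a => chi /Dq[].
  by split; [exact: qA|apply: Ha; left].
split; last first.
  by move=> D _ Dq; exists a => chi /Dq[[]//|]; exact: pa.
split=> [chi []//|D _ Dq|q qA qc aq]; first by exists a => chi /Dq[].
apply/seteqP; split=> // chi qchi; split; first exact: qA.
apply: contrapT => nchi.
have incons b : q (PForm phi b) -> q (PForm (FNeg phi) b) -> False.
  move=> h1 h2; have [|_ [->|->]//|x hx] :=
      qc [set PForm phi b; PForm (FNeg phi) b].
    by rewrite finite_setU; split; exact: finite_set1.
  by have := hx _ (or_intror erefl); apply; exact: (hx _ (or_introl erefl)).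
have [[b Ab E]|[b Ab E]] := qA _ qchi; subst chi.
  apply: (incons b) => //; apply: aq; split; first by right; exists b.
  exact: nchi.
apply: (incons b) => //; apply: aq; split; first by left; exists b.
by apply: contrapT => h; apply: nchi => h'; exact: h.
Qed.

End PhiTypes.

Local Open Scope ring_scope.

(** * Growth exponents *)

Section Growth.
Context (R : realType).

(** If [r < k], then [N ^ (k - r)] would stay bounded; [N] is chosen just above
the [(k - r)]-th root of the bound. *)
Lemma growth_exponent (k : nat) (r : R) (c : nat) (f : nat -> R) :
  f =O_\oo (fun N => N%:R `^ r) ->
  (forall N, (N ^ k)%:R <= f N * c%:R) -> k%:R <= r.
Proof.
move=> /eqOP/bigO_exP[M /= M0 fM] kf; rewrite leNgt; apply/negP => rk.
have e0 : 0 < k%:R - r by rewrite subr_gt0.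
have [N0 _ hN0] := fM.
pose B := M * c%:R + 1.
have B0 : 0 < B by rewrite ltr_wpDl// mulr_ge0// ltW.
pose N := maxn N0.+1 (Num.truncn (B `^ (k%:R - r)^-1)).+1.
have NB : B `^ (k%:R - r)^-1 < N%:R.
  apply: lt_le_trans (truncnS_gt _) _; rewrite ler_nat leq_max leqnn orbT//.
have N_gt0 : 0 < N%:R :> R by rewrite ltr0n leq_max.
have : B < N%:R `^ (k%:R - r).
  have := gt0_ltr_powR e0 _ _ NB; rewrite !nnegrE powR_ge0 ltW//.
  by move=> /(_ isT isT); rewrite -powRrM mulVf ?gt_eqF// powRr1// ltW.
rewrite powRB ?gt_eqF ?implybT//; rewrite powR_mulrn ?ltW//.
rewrite ltr_pdivlMr ?powR_gt0//.
rewrite ltNge => /negP; apply.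
have /= := hN0 N; rewrite leq_max leqnSn /= => /(_ isT) hf.
rewrite -natrX; apply: le_trans (kf N) _.
have : f N <= M * N%:R `^ r.
  by apply: le_trans (ler_norm _) _; apply: le_trans hf _; rewrite ger0_norm// powR_ge0.
move=> h; apply: le_trans (ler_wpM2r _ h) _ => //.
rewrite mulrAC ler_wpM2r ?powR_ge0// /B lerDl//.
Qed.

Lemma bigO_shift_expn (k c : nat) :
  (fun N => (c * N.+1 ^ k)%:R : R) =O_\oo (fun N => N%:R `^ (k%:R : R)).
Proof.
apply/eqOP/bigO_exP; exists ((c * 2 ^ k)%:R + 1) => /=; first by rewrite ltr_wpDl.
exists 1%N => // N /= N1.
rewrite powR_mulrn// -natrX !ger0_norm//.
 apply: (@le_trans _ _ ((c * 2 ^ k * N ^ k)%:R)).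
  rewrite ler_nat -mulnA leq_mul2l -expnMn; apply/orP; right.
  by case: (k) => [|k']; rewrite ?expn0// leq_exp2r// mul2n -addnn -addn1 leq_add2l.
by rewrite natrM ler_wpM2r// lerDl.
Qed.

End Growth.

Local Close Scope ring_scope.

(** * An inp-pattern of dependent formulas gives large density *)

(** A fibre of [g] consists of functions into the set [Z f] attached to any of
its members. *)
Lemma count_paths (k S N B : nat) (g : {ffun 'I_k -> 'I_N} -> 'I_S)
    (Z : {ffun 'I_k -> 'I_N} -> {set 'I_N}) :
  (forall f, (#|Z f| <= B)%N) ->
  (forall f f', g f = g f' -> forall al, f' al \in Z f) ->
  (N ^ k <= S * B ^ k)%N.
Proof.
move=> ZB gZ.
have -> : (N ^ k = \sum_(f : {ffun 'I_k -> 'I_N}) 1)%N.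
  by rewrite sum1_card card_ffun !card_ord.
rewrite (partition_big g xpredT) //= -[S in leqRHS]card_ord -sum_nat_const.
apply: leq_sum => s _; rewrite sum1_card.
have [f /eqP fs|none] := pickP [pred f | g f == s]; last first.
  by rewrite eq_card0.
have sub : {subset [pred f' | g f' == s] <= family (fun _ : 'I_k => mem (Z f))}.
  move=> f'; rewrite inE => /eqP f's; apply/familyP => al.
  by apply: gZ; rewrite fs f's.
apply: leq_trans (subset_leq_card (introT fintype.subsetP sub)) _.
rewrite card_family foldrE big_map big_enum /=.
apply: (@leq_trans (\prod_(al : 'I_k) B)%N); first by apply: leq_prod.
by rewrite prod_nat_const card_ord.
Qed.

Lemma increasing_enum (N r : nat) (Z : {set 'I_N}) : (r <= #|Z|)%N ->
  exists s : nat -> nat, increasing_on r s /\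
    forall i, (i < r)%N -> exists2 z, z \in Z & s i = val z.
Proof.
move=> rZ; have [N0|] := posnP N.
  have r0 : r = 0.
    apply/eqP; rewrite -leqn0; apply: leq_trans rZ _; apply: leq_trans (max_card _) _.
    by rewrite card_ord N0.
  by exists id; rewrite r0; split=> [i j|i]; rewrite ltn0 ?andbF.
case: N Z rZ => // N Z rZ _; exists (fun i => val (nth ord0 (enum Z) i)).
split=> [i j /andP[ij jr]|i ir]; last first.
  exists (nth ord0 (enum Z) i) => //.
  by rewrite -mem_enum mem_nth// -cardE; exact: leq_trans ir rZ.
have srt : sorted ltn [seq val z | z <- enum Z].
  apply: (subseq_sorted ltn_trans _ (iota_ltn_sorted 0 N.+1)).
  rewrite -val_enum_ord; apply: map_subseq; rewrite enumT; exact: filter_subseq.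
have jZ : (j < size (enum Z))%N by rewrite -cardE; exact: leq_trans jr rZ.
have := sorted_ltn_nth ltn_trans 0 srt i j.
rewrite !inE size_map jZ (ltn_trans ij jZ) => /(_ isT isT ij).
by rewrite !(nth_map ord0) //; exact: ltn_trans jZ.
Qed.

Section LowerBound.
Context (R : realType) (L : language) (K : Type) (U : structure L).
Hypotheses (K_lim : strong_limit K) (U_sat : saturated K U).
Context (C : set U) (C_small : small K C).
Context (n : nat) (p : set (pformula U 'I_n)) (pC : p `<=` params_in C).

(** One formula and one sequence carry all the rows: the [i]-th term of the
sequence lists the [i]-th entries of the rows, and the formula says that some
row is satisfied. The trace of a path through the rows has boundedly many
elements, so it comes from boundedly many paths. *)
Lemma density_of_array (k : nat) (l : 'I_k -> nat)
    (psi : forall al, formula L ('I_n + 'I_(l al)))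
    (d : forall al, nat -> 'I_(l al) -> U) (r : 'I_k -> nat) : (0 < k)%N ->
  (forall al, NIP U (psi al)) ->
  (forall f : 'I_k -> nat, exists a,
     realizes p a /\ instances psi (fun al => d al (f al)) a) ->
  (forall al (s : nat -> nat), increasing_on (r al) s ->
     ~ exists x, forall i, (i < r al)%N -> formula_rel (psi al) x (d al (s i))) ->
  exists (m : nat) (I : nat -> 'I_m -> U) (phi : formula L ('I_n + 'I_m)),
    [/\ indiscernible C I, NIP U phi
      & (k%:R%:E <= vc_dual_density R p phi (range I))%E].
Proof.
move=> k0 nip paths rows.
pose m := #|{: {al & 'I_(l al)}}|.
pose pr (al : 'I_k) (y : 'I_m -> U) (j : 'I_(l al)) : U :=
  y (enum_rank (Tagged (fun al => 'I_(l al)) j)).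
pose J i (t : 'I_m) : U := d (tag (enum_val t)) i (tagged (enum_val t)).
have prJ al i : pr al (J i) = d al i.
  by apply: funext => j; rewrite /pr /J enum_rankK.
have [phi hphi] : exists phi : formula L ('I_n + 'I_m),
    forall a b, formula_rel phi a b <-> exists al, formula_rel (psi al) a (pr al b).
  pose rn (al : 'I_k) (x : 'I_n + 'I_(l al)) : 'I_n + 'I_m :=
    match x with inl i => inl i
    | inr j => inr (enum_rank (Tagged (fun al => 'I_(l al)) j)) end.
  have [phi h] := definable_exfin (fun al =>
    definable_rename (rn al) (definable_eval U (psi al))).
  exists phi => a b; rewrite /formula_rel h; split=> -[al hal]; exists al; move: hal;
    have -> // : tuple_join a b \o rn al = tuple_join a (pr al b);
    by apply: funext => -[].
have nip_phi : NIP U phi by exact: (NIP_union K_lim U_sat hphi nip).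
have [I [Iind transfer]] := extract_indiscernible K_lim U_sat C_small J.
have rowsI al s : increasing_on (r al) s ->
    ~ exists x, forall i, (i < r al)%N -> formula_rel (psi al) x (pr al (I (s i))).
  move=> sinc.
  pose P (v : nat * 'I_m -> U) := ~ exists x, forall i, (i < r al)%N ->
    formula_rel (psi al) x (pr al (fun t => v (s i, t))).
  apply: (transfer (\max_(i < r al) s i).+1 P).
  - apply: pdefinable_not; apply: definable_pdefinable.
    apply: (definable_exV (P := fun z => forall i, (i < r al)%N -> formula_rel (psi al)
      (z \o inl) (z \o inr \o (fun j =>
        (s i, enum_rank (Tagged (fun al => 'I_(l al)) j)))))).
    by apply: definable_allnat => i _; exact: definable_formula_rel.
  - move=> v v' vv' Pv [x hx]; apply: Pv; exists x => i ir.
    have := hx i ir; rewrite /pr; congr formula_rel.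
    apply: funext => j; rewrite vv'// ltnS.
    exact: (leq_bigmax (Ordinal ir)).
  - move=> w winc; rewrite /P /= => -[x hx].
    apply: (rows al (w \o s)) => [i j /andP[ij jr]|].
      apply: winc; rewrite sinc ?ij// ltnS.
      exact: (leq_bigmax (Ordinal jr)).
    by exists x => i ir; have := hx i ir; rewrite -prJ.
have pathsI (f : 'I_k -> nat) : exists a,
    realizes p a /\ forall al, formula_rel (psi al) a (pr al (I (f al))).
  apply: (realize_instances K_lim U_sat C_small pC (psi := psi)) => D.
  pose P (v : nat * 'I_m -> U) := exists x, sat_part D x /\
    instances psi (fun al => pr al (fun t => v (f al, t))) x.
  apply: (transfer (\max_al f al).+1 P).
  - pose g (z : {al & 'I_(l al)}) : nat * 'I_m := (f (tag z), enum_rank z).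
    apply: (pdefinable_ext (pdefinable_rename g (ex_sat_part_pdefinable pC psi D))) => v.
    by [].
  - move=> v v' vv' [x [Dx hx]]; exists x; split=> // al.
    have := hx al; rewrite /pr; congr formula_rel.
    apply: funext => j; rewrite vv'// ltnS.
    exact: leq_bigmax.
  - move=> w _; have [a [pa ha]] := paths (fun al => w (f al)).
    exists a; split; first by move=> chi _; apply: pa; exact: svalP.
    by move=> al; have := ha al; rewrite -prJ.
exists m, I, phi; split=> //.
pose al0 : 'I_k := Ordinal k0.
have Iinj : injective I.
  suff H i j : (i < j)%N -> I i <> I j.
    by move=> i j E; have [ij|ij|//] := ltngtP i j; [case: (H _ _ ij)|case: (H _ _ ij)].
  move=> ij E.
  have Econst u : I 0 = I u.
    case: u => // u; apply: funext => t.
    pose i2 (a b : nat) (x : 'I_2) : nat := if val x is 0 then a else b.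
    have i2inc a b : (a < b)%N -> {homo i2 a b : s t / (s < t)%N >-> (s < t)%O}.
      by move=> ab [[|[|s]] hs] [[|[|s']] hs'].
    pose P (v : 'I_2 * 'I_m -> U) := v (ord0, t) = v (lift ord0 ord0, t).
    have dP : pdefinable C P by apply: definable_pdefinable; exact: definable_eq.
    have [_ Ih] := Iind.
    have := (same_type_pdefinable (Ih 2 _ _ (i2inc _ _ ij) (i2inc _ _ (ltn0Sn u))) dP).1.
    by apply; rewrite /P /= /i2 /= E.
  have [a [_ ha]] := pathsI (fun=> 0).
  apply: (rowsI al0 id) => [? ? /andP[]//|]; exists a => u _.
  by rewrite -Econst; exact: ha.
apply: le_ereal_inf_tmp => _ [e [e0 [f [f0 fO hf]]] <-].
rewrite lee_fin; pose B := (\sum_al r al)%N.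
apply: (growth_exponent (c := (B ^ k)%N) fO) => N.
pose A := [set I i | i in `I_N].
have [||S [cardS Sf]] := hf A N.
- by move=> _ [i _ <-]; exists i.
- by apply: inj_card_eq => i j _ _; exact: Iinj.
apply: (@le_trans _ _ ((S * B ^ k)%N%:R)%R); last by rewrite natrM ler_wpM2r.
rewrite ler_nat.
have sA : small K [set u | exists b, A b /\ exists j, b j = u].
  apply: (small_image (smallT_count K_lim (nat * 'I_m)%type) (f := fun z => I z.1 z.2)).
  by move=> u [_ [[i _ <-] [j <-]]]; exists (i, j).
have E := phi_types_realized K_lim U_sat C_small pC phi sA.
have /card_eqPle[cS _] := cardS.
have [g [ginj gS]] := card_le_exinj cS.
have [a ha] := choice pathsI.
pose F (f : {ffun 'I_k -> 'I_N}) (al : 'I_k) : nat := f al.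
have q u : phi_types p phi A (phi_type_of phi A (a (F u))).
  by rewrite E; exists (a (F u)) => //; exact: (ha (F u)).1.
pose g' (f : {ffun 'I_k -> 'I_N}) : 'I_S := Ordinal (gS (exist _ _ (q f))).
pose Z (f : {ffun 'I_k -> 'I_N}) : {set 'I_N} :=
  [set i : 'I_N | `[< formula_rel phi (a (F f)) (I i) >]]%SET.
clear f f0 fO hf Sf; apply: (@count_paths k S N B g' Z) => [f|f f' gff' al].
  have sub : Z f \subset (\bigcup_al
      [set i : 'I_N | `[< formula_rel (psi al) (a (F f)) (pr al (I i)) >]])%SET.
    apply/fintype.subsetP => i; rewrite inE => /asboolP/hphi[al hal].
    by apply/finset.bigcupP; exists al => //; rewrite inE; apply/asboolP.
  apply: leq_trans (subset_leq_card sub) _.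
  apply: (big_ind2 (fun (Y : {set 'I_N}) s => (#|Y| <= s)%N)) => [|Y s Y' s' Ys Ys'|j _].
  - by rewrite finset.cards0.
  - by apply: leq_trans (finset.leq_card_setU _ _).1 _; exact: leq_add.
  rewrite leqNgt; apply/negP => /ltnW /increasing_enum[t [tinc tZ]].
  apply: (rowsI j t tinc); exists (a (F f)) => i /tZ[z].
  by rewrite inE => /asboolP hz ->.
rewrite inE; apply/asboolP.
have /ginj[] : g (exist _ _ (q f)) = g (exist _ _ (q f')) by have /(congr1 val) := gff'.
move=> /phi_type_of_eq H; apply/(H (I (f' al))); first by exists (f' al) => //=.
by apply/hphi; exists al; exact: (ha (F f')).2.
Qed.

End LowerBound.

(** * Boolean words with few disjoint alternations *)

(** The number of disjoint pairs of adjacent different letters found by reading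
the word from the left; a word such as [0 1 0] has only one. *)
Fixpoint alternations (s : seq bool) : nat :=
  match s with
  | b :: (b' :: s') as t => if b == b' then alternations t else (alternations s').+1
  | _ => 0
  end.

(** A word whose first two letters agree is recovered from its tail. If they
differ, they use up one alternation and any word may follow. *)
Fixpoint few_alternations (N k : nat) : seq (seq bool) :=
  match k, N with
  | 0, _ => [::]
  | _, 0 => [:: [::]]
  | _, 1 => [:: [:: true]; [:: false]]
  | k'.+1, (N'.+1 as M).+1 =>
      [seq head true s :: s | s <- few_alternations M k] ++
      [seq [:: true, false & s] | s <- few_alternations N' k'] ++
      [seq [:: false, true & s] | s <- few_alternations N' k']
  end.

Lemma few_alternationsSS (N k : nat) : few_alternations N.+2 k.+1 =
  [seq head true s :: s | s <- few_alternations N.+1 k.+1] ++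
  [seq [:: true, false & s] | s <- few_alternations N k] ++
  [seq [:: false, true & s] | s <- few_alternations N k].
Proof. by []. Qed.

Lemma few_alternations0 (N : nat) : few_alternations N 0 = [::].
Proof. by case: N => [|[]]. Qed.

Arguments few_alternations : simpl never.

Lemma mem_few_alternations (s : seq bool) (k : nat) :
  (alternations s < k)%N -> s \in few_alternations (size s) k.
Proof.
have [N] := ubnP (size s); elim: N => // N IH in s k *.
case: k => // k; case: s => [|b [|b' s]] /=; [by []|by case: b|].
rewrite few_alternationsSS !ltnS => sN.
case: eqVneq => [<-|bb'] H; rewrite !mem_cat.
  apply/orP; left; apply/mapP; exists (b :: s) => //.
  by apply: (IH (b :: s)).
have {}H : s \in few_alternations (size s) k by apply: IH => //; exact: ltnW.
apply/orP; right; case: b bb' => bb'; case: b' bb' => // _; apply/orP.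
  by left; apply/mapP; exists s.
by right; apply/mapP; exists s.
Qed.

(** The recursion of the enumeration gives
[c(N + 2, k + 1) <= c(N + 1, k + 1) + 2 c(N, k)] for the number [c(N, k)] of
words of length [N] with fewer than [k] alternations. *)
Lemma size_few_alternations (N k : nat) :
  (size (few_alternations N k.+1) <= 2 ^ k.+1 * N.+1 ^ k)%N.
Proof.
have [M] := ubnP N; elim: M => // M IH in N k *.
case: N => [|[|N]] NM.
- by rewrite exp1n muln1 expn_gt0.
- by rewrite expnS -mulnA leq_pmulr// muln_gt0 !expn_gt0.
rewrite few_alternationsSS !size_cat !size_map.
have h1 : (size (few_alternations N.+1 k.+1) <= 2 ^ k.+1 * N.+2 ^ k)%N by apply: IH.
case: k h1 => [|k] h1; first by rewrite few_alternations0 !addn0; apply: leq_trans h1 _.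
have h2 : (size (few_alternations N k.+1) <= 2 ^ k.+1 * N.+1 ^ k)%N.
  by apply: IH; exact: ltnW.
apply: leq_trans (leq_add h1 (leq_add h2 h2)) _.
have : (N.+1 ^ k <= N.+3 ^ k)%N by case: (k) => // k'; rewrite leq_exp2r// ltnW.
have : (N.+2 ^ k <= N.+3 ^ k)%N by case: (k) => // k'; rewrite leq_exp2r.
rewrite (expnS N.+2) (expnS N.+3) (expnS 2 k.+1).
set a := (N.+1 ^ k)%N; set b := (N.+2 ^ k)%N; set c := (N.+3 ^ k)%N.
set e := (2 ^ k.+1)%N => bc ac.
have -> : (2 * e * (N.+2 * b) + (e * a + e * a) = 2 * e * (N.+2 * b + a))%N by lia.
rewrite leq_mul2l; apply/orP; right; rewrite [(N.+3 * c)%N]mulSn addnC.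
by apply: leq_add => //; rewrite leq_mul2l bc orbT.
Qed.

Lemma alternationsP (s : seq bool) (k : nat) : (k <= alternations s)%N ->
  exists u : nat -> nat, [/\ increasing_on (k * 2) u,
    forall i, (i < k * 2)%N -> (u i < size s)%N &
    forall i, (i < k)%N -> nth true s (u (i * 2)) != nth true s (u (i * 2).+1)].
Proof.
have [N] := ubnP (size s); elim: N => // N IH in s k *.
case: s => [|b [|b' s]] /=; try by
  move=> _; rewrite leqn0 => /eqP->; exists id; split=> // i j; rewrite ltn0 andbF.
rewrite !ltnS => sN; case: eqVneq => [_|bb'] ks.
  have [|u [uinc us ud]] := IH (b' :: s) k _ ks; first by [].
  by exists (fun i => (u i).+1); split=> // i /us.
case: k ks => [|k] ks; first by exists id; split=> // i j; rewrite ltn0 andbF.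
have [|u [uinc us ud]] := IH s k _ ks; first exact: ltnW.
exists (fun i => if i is i'.+2 then (u i').+2 else i); split.
- move=> [|[|i]] [|[|j]] //= /andP[ij jk]; rewrite !ltnS; apply: uinc.
  by move: ij jk; rewrite mulSn !ltnS => -> .
- by move=> [|[|i]] //=; rewrite mulSn !ltnS; exact: us.
- by move=> [|i] //=; rewrite ltnS => /ud.
Qed.

Lemma infinite_chain (d : Order.disp_t) (J : orderType d) :
  infinite_set [set: J] -> forall n, exists v : nat -> J,
    forall i j, (i < j < n)%N -> (v i < v j)%O.
Proof.
move=> /infiniteP/card_leT_inj[f finj] n.
pose s := sort <=%O [seq f i | i <- iota 0 n].
have ss : size s = n by rewrite size_sort size_map size_iota.
have srt : sorted <%O s.
  by rewrite sort_lt_sorted map_inj_uniq ?iota_uniq.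
exists (nth (f 0) s) => i j /andP[ij jn].
by have := sorted_ltn_nth lt_trans (f 0) srt i j; rewrite !inE ss jn (ltn_trans ij jn); exact.
Qed.

(** * Large density gives an inp-pattern *)

Section UpperBound.
Context (R : realType) (L : language) (K : Type) (U : structure L).
Hypotheses (K_lim : strong_limit K) (U_sat : saturated K U).
Context (C : set U) (C_small : small K C).
Context (n : nat) (p : set (pformula U 'I_n)) (pC : p `<=` params_in C).
Context (m : nat) (phi : formula L ('I_n + 'I_m)).

(** Separation of two parameters by [phi], without saying on which side [a]
is: the same formula then serves for alternations in both directions. *)
Definition differ (a : 'I_n -> U) (b b' : 'I_m -> U) : Prop :=
  ~ (formula_rel phi a b <-> formula_rel phi a b').

Lemma definable_differ (V : Type) (g g' : 'I_m -> V) :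
  definable (fun z : 'I_n + V -> U =>
    differ (z \o inl) (z \o inr \o g) (z \o inr \o g')).
Proof. by apply: definable_not; apply: definable_iff; exact: definable_formula_rel. Qed.

Section Sequence.
Context (d : Order.disp_t) (J : orderType d) (I : J -> 'I_m -> U).

Definition chain (l : nat) (u : nat -> J) : Prop :=
  forall i j, (i < j < l)%N -> (u i < u j)%O.

Lemma chain_transfer (l : nat) (u v : nat -> J) (P : ('I_l * 'I_m -> U) -> Prop) :
  indiscernible C I -> pdefinable C P -> chain l u -> chain l v ->
  P (fun st => I (u st.1) st.2) -> P (fun st => I (v st.1) st.2).
Proof.
move=> [_ ind] dP cu cv.
have inc w : chain l w -> {homo (fun s : 'I_l => w s) : s t / (s < t)%N >-> (s < t)%O}.
  by move=> cw s t st; apply: cw; rewrite st /=.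
by move/(same_type_pdefinable (ind l _ _ (inc u cu) (inc v cv)) dP).
Qed.

(** If no realization of [p] separates [k + 1] disjoint adjacent pairs of a
chain, the [phi]-types over [N] terms are coded by words of length at most [N]
with at most [k] alternations. *)
Lemma separated_pairs (k : nat) : infinite_set [set: J] ->
  ((k%:R)%:E < vc_dual_density R p phi (range I))%E ->
  exists a u, [/\ realizes p a, chain (k.+1 * 2) u &
    forall i, (i < k.+1)%N -> differ a (I (u (i * 2))) (I (u (i * 2).+1))].
Proof.
move=> Jinf kd; apply: contrapT => nsep.
suff : (vc_dual_density R p phi (range I) <= (k%:R)%:E)%E by rewrite leNgt kd.
apply: ge_ereal_inf; exists (k%:R)%:E => //; exists k%:R%R => //; split=> //.
exists (fun N => (2 ^ k.+1 * N.+1 ^ k)%N%:R%R); split=> //.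
  exact: bigO_shift_expn.
move=> A N AI AN.
have fA : finite_set A by exists N.
have [s hs] := finite_set_seq fA.
have [u0] := carrier_inhabited U.
have [j0 _] := infinite_setN0 Jinf.
pose t := undup s.
have tA b : A b <-> (b : {classic 'I_m -> U}) \in t by rewrite mem_undup.
have tN : (size t <= N)%N.
  rewrite -card_le_II; have /card_eqPle[AN' _] := AN; apply: card_le_trans AN'.
  apply: (@card_le_inj _ _ _ _ (fun i => nth ((fun=> u0) : {classic 'I_m -> U}) t i)).
    by move=> i it; apply/tA; exact: mem_nth.
  by move=> i j it jt /eqP; rewrite nth_uniq ?undup_uniq// => /eqP.
have hj (b : {classic 'I_m -> U}) : exists j, b \in t -> I j = b.
  have [/tA/AI[j _ jb]|] := boolP (b \in t); first by exists j.
  by exists j0.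
have [jf hjf] := choice hj.
pose js := sort <=%O [seq jf b | b <- t].
have sjs : (size js <= N)%N by rewrite size_sort size_map.
have srt : sorted <%O js.
  rewrite sort_lt_sorted map_inj_in_uniq ?undup_uniq// => b b' bt b't E.
  by rewrite -(hjf b bt) -(hjf b' b't) E.
have jsA b : A b -> exists2 j, j \in js & I j = b.
  move=> /tA bt; exists (jf b); last exact: hjf.
  by rewrite mem_sort; exact: map_f.
pose word a := [seq `[< formula_rel phi a (I j) >] | j <- js].
have alt a : realizes p a -> (alternations (word a) < k.+1)%N.
  move=> pa; rewrite ltnNge; apply/negP => /alternationsP[u [uinc us ud]].
  rewrite size_map in us.
  apply: nsep; exists a, (fun i => nth j0 js (u i)); split=> //.
    move=> i j /andP[ij jk]; have ik := ltn_trans ij jk.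
    have := sorted_ltn_nth lt_trans j0 srt (u i) (u j).
    by rewrite !inE us// us// => /(_ isT isT); apply; apply: uinc; rewrite ij.
  move=> i ik E; have /eqP[] := ud i ik.
  have h1 : (i * 2 < k.+1 * 2)%N by rewrite ltn_mul2r.
  have h2 : ((i * 2).+1 < k.+1 * 2)%N by lia.
  by rewrite !(nth_map j0) ?us//; exact: asbool_equiv_eq.
have wordE a a' : word a = word a' -> phi_type_of phi A a = phi_type_of phi A a'.
  move=> /eq_in_map E; apply/phi_type_of_eq => b /jsA[j jjs <-].
  have := E j jjs; split=> /asboolP; first by rewrite E// => /asboolP.
  by rewrite -E// => /asboolP.
have sA : small K [set u | exists b, A b /\ exists j, b j = u].
  apply: (small_image (smallT_count K_lim (nat * 'I_m)%type)
    (f := fun z => nth ((fun=> u0) : {classic 'I_m -> U}) t z.1 z.2)).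
  move=> u [b [/tA bt [j <-]]]; exists (index (b : {classic 'I_m -> U}) t, j) => /=.
  by rewrite nth_index.
have E := phi_types_realized K_lim U_sat C_small pC phi sA.
pose few := few_alternations (size js) k.+1.
have le : phi_types p phi A #<= `I_(size few).
  have ha q : exists a, phi_types p phi A q -> realizes p a /\ q = phi_type_of phi A a.
    have [|nq] := pselect (phi_types p phi A q); last by exists (fun=> u0).
    by rewrite {1}E => -[a pa <-]; exists a.
  have [f hf] := choice ha.
  have hw q : phi_types p phi A q -> word (f q) \in few.
    move=> /hf[pf _]; have := mem_few_alternations (alt _ pf).
    by rewrite size_map.
  apply: (@card_le_inj _ _ _ _ (fun q => index (word (f q)) few)) => [q hq|q q' hq hq' iq].
    by rewrite /= index_mem; exact: hw.
  rewrite (hf q hq).2 (hf q' hq').2; apply: wordE.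
  by rewrite -(nth_index [::] (hw q hq)) iq nth_index// hw.
have [S cS] : finite_set (phi_types p phi A) by apply: card_le_finite le _; exists (size few).
exists S; split=> //; rewrite ler_nat.
apply: (@leq_trans (size few)).
  by rewrite -card_le_II -(card_le_eql cS).
apply: leq_trans (size_few_alternations _ _) _.
by rewrite leq_mul2l; apply/orP; right; case: (k) => // k'; rewrite leq_exp2r.
Qed.

(** A long chain of disjoint pairs, all separated by one [a], would contain
chains with every prescribed trace; by indiscernibility, any chain of the same
length would then be shattered. *)
Lemma alternation_bound : NIP U phi -> indiscernible C I ->
  exists N, forall u : nat -> J, chain (N * 2) u ->
    ~ exists a, forall i, (i < N)%N -> differ a (I (u (i * 2))) (I (u (i * 2).+1)).
Proof.
move=> nip ind; have [N nsh] := NIP_dual K_lim U_sat nip.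
exists N => u cu [a ha]; apply: nsh.
exists (fun i => I (u (i * 2))) => S.
pose tr (i : nat) : bool := if insub i is Some i' then (i' : 'I_N) \in S else true.
(* In each pair, choose the member on the side prescribed by [S]. *)
pose v (i : nat) := if `[< formula_rel phi a (I (u (i * 2))) >] == tr i
  then u (i * 2) else u (i * 2).+1.
have hv i : (i < N)%N -> formula_rel phi a (I (v i)) <-> tr i.
  move=> iN; rewrite /v; case: eqP => [<-|ne]; first by split=> /asboolP.
  have := ha i iN; rewrite /differ; move: ne.
  case: (tr i) => ne dif; split=> // h; apply: contrapT => h'.
    by apply: dif; split=> // h''; case: ne; exact: asboolT.
  by apply: dif; split=> // _; apply: contrapT => h''; case: ne; exact: asboolF.
have cv : chain N v.
  move=> i j /andP[ij jN].
  have lt s t : (s < t < N * 2)%N -> (u s < u t)%O by exact: cu.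
  by rewrite /v; do 2 case: ifP => _; apply: lt; lia.
have cu2 : chain N (fun i => u (i * 2)) by move=> i j ijN; apply: cu; lia.
pose P (w : 'I_N * 'I_m -> U) := exists x, forall i : 'I_N,
  formula_rel phi x (fun t => w (i, t)) <-> i \in S.
have dP : pdefinable C P.
  apply: definable_pdefinable.
  apply: (definable_exV (P := fun z => forall i : 'I_N,
    formula_rel phi (z \o inl) (z \o inr \o pair i) <-> i \in S)).
  apply: definable_allfin => i; apply: definable_iff; first exact: definable_formula_rel.
  exact: definable_const.
apply: (chain_transfer ind dP cv cu2).
by exists a => i; have := hv i (ltn_ord i); rewrite /tr valK.
Qed.

(** Blocks of one chain, cut into pairs, form the rows of an inp-pattern. *)
Lemma pattern_of_density (k : nat) : NIP U phi -> indiscernible C I ->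
  ((k%:R)%:E < vc_dual_density R p phi (range I))%E ->
  exists (e : 'I_k.+1 -> nat -> 'I_m -> U) (N : nat),
    (forall (f : 'I_k.+1 -> nat) (D : seq {classic {psi | p psi}}),
       exists a, sat_part D a /\
       forall al, differ a (e al (f al * 2)) (e al (f al * 2).+1)) /\
    (forall al (s : nat -> nat), increasing_on N s -> ~ exists a,
       forall i, (i < N)%N -> differ a (e al (s i * 2)) (e al (s i * 2).+1)).
Proof.
move=> nip ind kd; have Jinf := ind.1.
have [a [u [pa cu au]]] := separated_pairs Jinf kd.
have [N hN] := alternation_bound nip ind.
pose part := seq {classic {psi | p psi}}.
pose X : Type := ('I_k.+1 * nat * 'I_m)%type.
pose ent (v : X -> U) al i : 'I_m -> U := fun j => v (al, i, j).
pose G : Type := part * ('I_k.+1 -> nat) +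
  {z : 'I_k.+1 * (nat -> nat) | increasing_on N z.2}.
pose Gr (z : G) (v : X -> U) : Prop := match z with
  | inl (D, f) => exists x, sat_part D x /\
      forall al, differ x (ent v al (f al * 2)) (ent v al (f al * 2).+1)
  | inr (exist (al, s) _) => ~ exists x, forall i, (i < N)%N ->
      differ x (ent v al (s i * 2)) (ent v al (s i * 2).+1)
  end.
have ev_lt (i : 'I_k.+1) : (i * 2 < k.+1 * 2)%N by rewrite ltn_mul2r ltn_ord.
have od_lt (i : 'I_k.+1) : ((i * 2).+1 < k.+1 * 2)%N by have := ltn_ord i; lia.
have dExists (V : Type) (D : part) (g g' : 'I_k.+1 -> 'I_m -> V) :
    pdefinable C (fun v : V -> U => exists x, sat_part D x /\
      forall al, differ x (v \o g al) (v \o g' al)).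
  apply: (pdefinable_exV (P := fun z => sat_part D (z \o inl) /\
    forall al, differ (z \o inl) (z \o inr \o g al) (z \o inr \o g' al))).
  apply: pdefinable_and.
    exact: (pdefinable_rename inl (sat_part_pdefinable pC D (@subset_refl _ C))).
  by apply: pdefinable_allfin => al; exact/definable_pdefinable/definable_differ.
have halfE i : ((i * 2) %/ 2 = i)%N * ((i * 2) %% 2 = 0)%N *
    ((i * 2).+1 %/ 2 = i)%N * ((i * 2).+1 %% 2 = 1)%N by do !split; lia.
have [||z|s|v hv] := compactness K_lim U_sat (X := X) (A := C) (G := Gr).
- exact: smallT_count.
- exact: C_small.
- case: z => [[D f]|[[al s] sinc]].
    exact: (dExists _ D (fun al j => (al, f al * 2, j)%N) (fun al j => (al, (f al * 2).+1, j)%N)).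
  apply: pdefinable_not; apply: definable_pdefinable.
  apply: (definable_exV (P := fun z => forall i, (i < N)%N ->
    differ (z \o inl) (z \o inr \o (fun j => (al, s i * 2, j)%N))
      (z \o inr \o (fun j => (al, (s i * 2).+1, j)%N)))).
  by apply: definable_allnat => i _; exact: definable_differ.
- pose bd (z : {classic G}) : nat := match (z : G) with
    | inl (D, f) => \max_al f al
    | inr (exist (al, s) _) => \max_(i < N) s i end.
  have [B hB] := seq_bound s bd.
  have [w cw] := infinite_chain Jinf (k.+1 * (B * 2))%N.
  exists (fun z : X => I (w (z.1.1 * (B * 2) + z.1.2)%N) z.2) => z zs.
  have := hB z zs; case: z {zs} => [[D f]|[[al t] tinc]] /= hz.
    have fB al : (f al < B)%N by apply: leq_ltn_trans hz; exact: leq_bigmax.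
    pose F i := if insub i is Some al then f al else 0.
    have FE (al : 'I_k.+1) : F al = f al by rewrite /F valK.
    have FB i : (i < k.+1)%N -> (F i < B)%N by move=> ik; rewrite /F insubT; exact: fB.
    (* Block number [al] has [2 B] terms and contributes its pair number [f al]. *)
    pose g i := ((i %/ 2) * (B * 2) + F (i %/ 2) * 2 + i %% 2)%N.
    have cg : chain (k.+1 * 2) (w \o g).
      move=> i j /andP[ij jk]; apply: cw; rewrite /g.
      have hi : (i %/ 2 < k.+1)%N by lia.
      have hj : (j %/ 2 < k.+1)%N by lia.
      have Fi := FB _ hi; have Fj := FB _ hj.
      apply/andP; split; last by nia.
      have [E|ne] := eqVneq (i %/ 2) (j %/ 2); first by rewrite E ltn_add2l; lia.
      have : (i %/ 2 < j %/ 2)%N by lia.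
      by nia.
    pose P (y : 'I_(k.+1 * 2) * 'I_m -> U) := exists x, sat_part D x /\
      forall al, differ x (y \o pair (Ordinal (ev_lt al))) (y \o pair (Ordinal (od_lt al))).
    have dP : pdefinable C P by exact: dExists.
    have [|x [Dx hx]] := chain_transfer ind dP cu cg.
      exists a; split; first by move=> chi _; apply: pa; exact: svalP.
      by move=> al; exact: au.
    exists x; split=> // al; have := hx al; rewrite /comp /= /g !halfE FE.
    by rewrite addn0 -addnA addn1.
  have tB i : (i < N)%N -> (t i < B)%N.
    by move=> iN; apply: leq_ltn_trans hz; exact: (leq_bigmax (Ordinal iN)).
  pose g i := (al * (B * 2) + (t (i %/ 2) * 2 + i %% 2))%N.
  have cg : chain (N * 2) (w \o g).
    move=> i j /andP[ij jN]; apply: cw; rewrite /g ltn_add2l.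
    have hi : (i %/ 2 < N)%N by lia.
    have hj : (j %/ 2 < N)%N by lia.
    have := tB _ hj; have := ltn_ord al => alk tj.
    apply/andP; split; last by nia.
    have [E|ne] := eqVneq (i %/ 2) (j %/ 2); first by rewrite E ltn_add2l; lia.
    have : (t (i %/ 2) < t (j %/ 2))%N by apply: tinc; lia.
    by lia.
  move=> [x hx]; apply: (hN _ cg); exists x => i iN.
  have := hx i iN; rewrite /ent /= /g !halfE.
  by rewrite addn0 addn1.
exists (ent v), N; split=> [f D|al s sinc]; first exact: (hv (inl (D, f))).
exact: (hv (inr (exist _ (al, s) sinc))).
Qed.

End Sequence.
End UpperBound.

(** * Burden and finite inp-patterns *)

Section Burden.
Context (L : language) (K : Type) (U : structure L).
Hypothesis K_lim : strong_limit K.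
Context (n : nat) (p : set (pformula U 'I_n)).

Let member : Type := {psi | p psi}.
Let part : Type := seq {classic member}.

Lemma part_of_seq (s : seq {classic pformula U 'I_n}) :
  exists D : part, forall a, sat_part D a ->
    forall psi : {classic pformula U 'I_n}, psi \in s -> p psi -> sat a psi.
Proof.
exists (pmap (fun psi : {classic pformula U 'I_n} =>
  if pselect (p psi) is left h then Some (exist p psi h : {classic member}) else None) s).
move=> a Da psi ps ppsi; apply: (Da (exist p psi ppsi)).
rewrite mem_pmap; apply/mapP; exists psi => //.
by case: pselect => // h; congr Some; exact: eq_exist.
Qed.

Lemma nat_injection : exists iota : nat -> K, injective iota.
Proof. by have [/card_leT_inj] := smallT_nat K_lim. Qed.

Lemma inp_pattern_card_le (X Y : set K) :
  X #<= Y -> inp_pattern p Y -> inp_pattern p X.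
Proof.
move=> XY [sY [m [phi [b [r [rows paths]]]]]]; split; first exact: small_card_le sY.
have [iota _] := nat_injection.
have [g [ginj gY]] := card_le_exinj XY.
pose g' al := if pselect (X al) is left h then g (exist _ al h) else iota 0.
have g'X al (h : X al) : g' al = g (exist _ al h).
  by rewrite /g'; case: pselect => // h'; congr g; exact: eq_exist.
exists (m \o g'), (fun al => phi (g' al)), (fun al => b (g' al)), (r \o g').
split=> [al Xal|f]; first by apply: rows; rewrite g'X.
pose inv be al := X al /\ g' al = be.
have hf be : exists i, forall al, inv be al -> i = f al.
  have [[al [Xal alE]]|none] := pselect (exists al, inv be al).
    exists (f al) => al' [Xal' al'E]; congr f.
    by move: al'E; rewrite -alE !g'X => /ginj [].
  by exists 0 => al h; case: none; exists al.
have [f' hf'] := choice hf.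
move=> D fD Ds; apply: (paths f' D fD) => psi /Ds[[al Xal <-]|]; last by right.
left; exists (g' al); first by rewrite g'X.
by rewrite (hf' _ al).
Qed.

Lemma rows_of_inp_pattern (k : nat) (X : set K) :
  `I_k #<= X -> inp_pattern p X ->
  exists (m : 'I_k -> nat) (phi : forall al, formula L ('I_n + 'I_(m al)))
    (b : forall al, nat -> 'I_(m al) -> U) (r : 'I_k -> nat),
    (forall al, k_inconsistent (r al) (fun i => PForm (phi al) (b al i))) /\
    (forall (f : 'I_k -> nat) (D : part),
       exists x, sat_part D x /\ instances phi (fun al => b al (f al)) x).
Proof.
move=> kX [_ [m [phi [b [r [rows paths]]]]]].
have [g0 [g0inj g0X]] := card_le_exinj kX.
pose g (i : 'I_k) : K := g0 (exist _ (val i) (ltn_ord i)).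
have ginj : injective g by move=> i j /g0inj [E]; exact: val_inj.
exists (m \o g), (fun i => phi (g i)), (fun i => b (g i)), (r \o g).
split=> [i|f D]; first exact: rows (g0X _).
have hf be : exists i, forall j, g j = be -> i = f j.
  have [[j jE]|none] := pselect (exists j, g j = be).
    by exists (f j) => j' j'E; congr f; apply: ginj; rewrite jE.
  by exists 0 => j jE; case: none; exists j.
have [f' hf'] := choice hf.
pose inst (i : 'I_k) : {classic pformula U 'I_n} := PForm (phi (g i)) (b (g i) (f i)).
pose val_of (z : {classic member}) : {classic pformula U 'I_n} := sval (z : member).
pose s : seq {classic pformula U 'I_n} :=
  [seq inst i | i <- enum 'I_k] ++ [seq val_of z | z <- D].
have sP (psi : {classic pformula U 'I_n}) : psi \in s ->
    ([set PForm (phi al) (b al (f' al)) | al in X] `|` p) psi.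
  rewrite mem_cat => /orP[/mapP[i _ ->]|/mapP[z _ ->]]; last by right; exact: (svalP (z : member)).
  by left; exists (g i); [exact: g0X|rewrite (hf' _ i)].
have [psi|x hx] := paths f' _ (seq_finite_set s); first exact: sP.
exists x; split=> [z zD|i].
  by apply: hx; rewrite /= mem_cat; apply/orP; right; exact: (map_f val_of).
have := hx (inst i); apply; rewrite /= mem_cat; apply/orP; left.
by apply: map_f; rewrite mem_enum.
Qed.

(** The rows are indexed by the image of an initial segment of [nat] in [K]; the
row formula separates the two halves of its parameter. *)
Lemma inp_pattern_of_rows (m k N : nat) (phi : formula L ('I_n + 'I_m))
    (e : 'I_k.+1 -> nat -> 'I_m -> U) :
  (forall (f : 'I_k.+1 -> nat) (D : part), exists a, sat_part D a /\
     forall al, differ phi a (e al (f al * 2)) (e al (f al * 2).+1)) ->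
  (forall al (s : nat -> nat), increasing_on N s -> ~ exists a,
     forall i, (i < N)%N -> differ phi a (e al (s i * 2)) (e al (s i * 2).+1)) ->
  exists X : set K, inp_pattern p X /\ `I_k.+1 #<= X.
Proof.
move=> paths rows; have [iota iinj] := nat_injection.
pose X : set K := iota @` `I_k.+1.
exists X; split; last first.
  by apply: (@card_le_inj _ _ _ _ iota) => [i ik|i j _ _ /iinj//]; exists i.
have hinv be : exists i, forall j, iota j = be -> i = j.
  have [[j jE]|none] := pselect (exists j, iota j = be).
    by exists j => j' j'E; apply: iinj; rewrite jE.
  by exists 0 => j jE; case: none; exists j.
have [inv hinv'] := choice hinv.
pose row (be : K) : 'I_k.+1 := inord (inv be).
have [chi hchi] := definable_differ U phi (@lshift m m) (@rshift m m).
pose b (be : K) i (t : 'I_(m + m)) : U := match fintype.split t with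
  | inl j => e (row be) (i * 2) j | inr j => e (row be) (i * 2).+1 j end.
have bP x be i : sat x (PForm chi (b be i)) <->
    differ phi x (e (row be) (i * 2)) (e (row be) (i * 2).+1).
  rewrite /sat /= hchi.
  have -> : tuple_join x (b be i) \o inr \o @lshift m m = e (row be) (i * 2).
    by apply: funext => j; rewrite /b /= (unsplitK (inl j)).
  have -> // : tuple_join x (b be i) \o inr \o @rshift m m = e (row be) (i * 2).+1.
  by apply: funext => j; rewrite /b /= (unsplitK (inr j)).
split.
  by apply: (small_image (smallT_nat K_lim) (f := iota)) => _ [i _ <-]; exists i.
exists (fun=> m + m), (fun=> chi), b, (fun=> N); split=> [be _ i iin|f].
  move=> [x hx]; pose l := sort leq [seq i j | j <- enum 'I_N].
  have sl : size l = N by rewrite size_sort size_map -cardE card_ord.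
  have srt : sorted ltn l.
    rewrite ltn_sorted_uniq_leq sort_uniq map_inj_uniq// enum_uniq /=.
    exact: (sort_sorted leq_total).
  apply: (rows (row be) (nth 0 l)) => [s t /andP[st tN]|].
    have := sorted_ltn_nth ltn_trans 0 srt s t.
    by rewrite !inE sl tN (ltn_trans st tN); exact.
  exists x => s sN.
  have : nth 0 l s \in l by rewrite mem_nth// sl.
  by rewrite mem_sort => /mapP[j _ ->]; apply/bP; exact: hx.
move=> D /finite_set_seq[s hs] Ds; have [D' hD'] := part_of_seq s.
have [x [Dx hx]] := paths (fun i => f (iota i)) D'.
exists x => psi Dpsi; have [[be [i ik <-] <-]|ppsi] := Ds psi Dpsi.
  apply/bP; have := hx (row (iota i)).
  by rewrite /row (hinv' _ i)// inordK.
exact: hD' Dx psi ((hs psi).1 Dpsi) ppsi.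
Qed.

(** If no inp-pattern has maximal depth, the least upper bound of the depths is a
cardinal of least size among all upper bounds. *)
Lemma is_bdn_exists : exists v : card_star K, is_bdn p v.
Proof.
have [[X [pX maxX]]|nomax] := pselect (exists X : set K, inp_pattern p X /\
    forall Y : set K, inp_pattern p Y -> Y #<= X); first by exists (Card X).
pose ub := {Z : set K | forall Y : set K, inp_pattern p Y -> Y #<= Z}.
have ub0 : inhabited ub by constructor; exists setT => Y _; exact: card_leT.
have [[X Xub] Xmin] := minimal_cardinal (fun Z : ub => {x | sval Z x}) ub0.
exists (CardMinus X); split=> // [Z Zub|pX]; last by apply: nomax; exists X.
have /= := Xmin (exist _ Z Zub).
move=> XZ; apply: card_le_trans (card_sigl X) (card_le_trans XZ (card_sigr Z)).
Qed.

(** A supremum that is not attained lies above [k] only if some depth does,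
since otherwise [k] itself would be an upper bound. *)
Lemma bdn_geP (k : nat) :
  bdn_ge K p k <-> exists X : set K, inp_pattern p X /\ `I_k #<= X.
Proof.
split=> [[[X|X]] []|[X [pX kX]]].
- by move=> [pX _] /= kX; exists X.
- move=> [_ least _] /= [_ nXk]; apply: contrapT => none; apply: nXk.
  have [iota iinj] := nat_injection.
  have eI : iota @` `I_k #= `I_k by apply: inj_card_eq => i j _ _; exact: iinj.
  have /card_eqPle[Ik kI] := eI.
  apply: card_le_trans Ik; apply: least => Y pY; apply: card_le_trans kI.
  have [YI|IY] := card_le_total {x | Y x} {x | `I_k x}.
    exact: card_le_trans (card_sigl Y) (card_le_trans YI (card_sigr _)).
  case: none; exists Y; split=> //.
  exact: card_le_trans (card_sigl _) (card_le_trans IY (card_sigr _)).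
have [[Y|Y] pv] := is_bdn_exists.
  by exists (Card Y); split=> //=; apply: card_le_trans kX _; exact: pv.2.
exists (CardMinus Y); split=> //=; have [maxY _ nY] := pv.
split=> [|Yk]; first exact: card_le_trans kX (maxY _ pX).
by apply: nY; apply: inp_pattern_card_le pX; exact: card_le_trans Yk kX.
Qed.

End Burden.

Local Open Scope ring_scope.

Theorem corollary3p15 (R : realType) (L : language) (T : set (sentence L))
    (K : Type) (U : structure L)
    (T_complete : complete_theory T) (U_monster : monster T K U)
    (T_dd : dependent_dividing K U)
    (C : set U) (C_small : small K C)
    (n : nat) (p : set (pformula U 'I_n)) (p_type : type_over C p)
    (k : nat) :
  [<-> bdn_ge K p k;
       exists (m : nat) (d : Order.disp_t) (J : orderType d)
              (I : J -> 'I_m -> U) (phi : formula L ('I_n + 'I_m)),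
         [/\ small K [set: J], indiscernible C I, NIP U phi
           & (k%:R%:E <= vc_dual_density R p phi (range I))%E];
       exists (m : nat) (d : Order.disp_t) (J : orderType d)
              (I : J -> 'I_m -> U) (phi : formula L ('I_n + 'I_m)),
         [/\ small K [set: J], indiscernible C I, NIP U phi
           & ((k%:R - 1)%:E < vc_dual_density R p phi (range I))%E]].
Proof.
have [_ [K_lim sf sr] U_sat _] := U_monster.
have [pC pcons] := p_type.
tfae.
- move=> /(bdn_geP K_lim)[X [pX kX]].
  have [m [phi [b [r [rows paths]]]]] := rows_of_inp_pattern kX pX.
  have [k0|k_gt0] := posnP k.
    have [u0] := carrier_inhabited U.
    exists 0%N, _, (nat : orderType _), (fun _ _ => u0), FBot; split.
    + exact: smallT_nat.
    + by split=> [|l i j _ _ psi _]; first exact: infinite_nat.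
    + by move=> [a [c /(_ 0%N setT)[_ /(_ Logic.I)]]].
    + apply: le_ereal_inf_tmp => _ [e [e0 _] <-].
      by rewrite k0 lee_fin.
  have [l [psi [d [N [nip path row]]]]] :=
    dependent_array K_lim U_sat sf sr T_dd C_small pC rows paths.
  have [m' [I [chi [ind nip_chi dens]]]] :=
    density_of_array R K_lim U_sat C_small pC k_gt0 nip path row.
  by exists m', _, (nat : orderType _), I, chi; split=> //; exact: smallT_nat.
- move=> [m [d [J [I [phi [sJ ind nip dens]]]]]].
  exists m, d, J, I, phi; split=> //; apply: lt_le_trans dens.
  by rewrite lte_fin gtrBl.
- move=> [m [d [J [I [phi [_ ind nip dens]]]]]]; apply/(bdn_geP K_lim).
  have [k0|] := posnP k; last case: k dens => // k dens _.
    exists set0; rewrite k0 II0; split; last exact: card_ge0.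
    split; first by apply: small_card_le (smallT_nat K_lim); exact: card_ge0.
    exists (fun=> 0%N), (fun=> FBot),
      (fun _ _ (i : 'I_0) => False_rect U (notF (ltn_ord i))), (fun=> 0%N).
    split=> // f; rewrite image_set0 set0U.
    exact: pcons.
  have [|e [N [paths rows]]] := pattern_of_density (R := R) K_lim U_sat C_small pC
    (k := k) nip ind.
    by move: dens; rewrite -addn1 natrD addrK.
  exact: inp_pattern_of_rows paths rows.
Qed.
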